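(* The multisets $S_{u,\varphi}$ characterize $\varphi$, in the following sense: let $\varphi,\psi$ be automorphisms of the free group $F_n$ in different conjugacy classes (that is, representing different classes in $\mathrm{Out}(F_n)$). Then there exists a u-word $u$ such that $S_{u,\varphi}\neq S_{u,\psi}$.
   Context: Words as graphs. Graphs are in the sense of Serre: vertices, edges, an initial vertex map $\iota$ and a fixed-point-free involution $e\mapsto\bar e$ on edges; morphisms commute with this structure. Fix a basis $X$ of $F_n$ ($|X|=n$). $R_X$ is the graph with one vertex and edge set $X\cup X^{-1}$, $\bar x=x^{-1}$. An $X$-labeled graph is a graph $\Gamma$ with a morphism $\Lambda:\Gamma\to R_X$; morphisms of labeled graphs commute with the labels. It is folded if distinct edges with the same initial vertex have distinct labels. Folding means repeatedly identifying two edges with the same initial vertex and label (and their terminal vertices and inverse edges); for a finite labeled graph the folded result is unique. $u\cdot v$ denotes a product of reduced words without cancellation. A u-word (unoriented word) is a folded labeled graph homeomorphic to a compact line segment, taken up to isomorphism; a reduced word $u\ne 1$ gives the u-word $\overline u=\overline{u^{-1}}$, and $u,u^{-1}$ are its orientations (the bar is often dropped). A cyclic word is a folded labeled graph homeomorphic to a circle; it corresponds to a nontrivial cyclically reduced word up to cyclic permutation and inversion. For an automorphism $\varphi$, $\varphi(\overline u)=\overline{\varphi(u)}$ with $\varphi(u)$ reduced, and for a cyclic word $w$, $\varphi(w)$ is the cyclic word given by the cyclic reduction of $\varphi(w')$ for a representative $w'$ of $w$. The functors. For a labeled graph $\Delta$, $\mathcal F_\varphi(\Delta)$ is the labeled graph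 obtained by replacing every edge $e$ by a path labeled by the reduced word $\varphi(\Lambda(e))$, and $\tilde{\mathcal F}_\varphi(\Delta)$ is the result of folding $\mathcal F_\varphi(\Delta)$; both are functorial in $\Delta$. For a u-word $v$, $\tilde{\mathcal F}_\varphi(v)$ is a tree containing $\varphi(v)$ as the segment joining the images of the two endpoints of $\mathcal F_\varphi(v)$; for a cyclic word $w$, $\tilde{\mathcal F}_\varphi(w)$ contains $\varphi(w)$ as its embedded circle. The maps $\varphi(v)\to\tilde{\mathcal F}_\varphi(v)$ and $\varphi(w)\to\tilde{\mathcal F}_\varphi(w)$ are these inclusions. Compatibility. Given u-words $u,v$, a u-word or cyclic word $w$, and morphisms $u\to\varphi(v)$, $u\to\varphi(w)$, $v\to w$, call them compatible if the composites $u\to\varphi(v)\to\tilde{\mathcal F}_\varphi(v)\to\tilde{\mathcal F}_\varphi(w)$ and $u\to\varphi(w)\to\tilde{\mathcal F}_\varphi(w)$ agree. Ideal preimages. An ideal preimage of $u$ with respect to $\varphi$ is a pair consisting of a u-word $v$ (its base word) and a morphism $u\to\varphi(v)$ such that for every u-word $w$ and every morphism $v\to w$ there is a morphism $u\to\varphi(w)$ compatible with them. It is denoted $u\to\varphi(v)$. Full sets. A set $S$ of ideal preimages of $u$ is a full set if for every cyclic word $w$ and every morphism $u\to\varphi(w)$ there is a unique ideal preimage $u\to\varphi(v)$ in $S$ for which there is a morphism $v\to w$ making the three morphisms compatible. A full paradigm of a morphism $\overline u\to\varphi(\overline v)$ (with $v$ an orientation of $\overline v$) is a set of morphisms $\overline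 u\to\varphi(\overline{v_1}),\dots,\overline u\to\varphi(\overline{v_{2n-1}})$ such that $\{\overline{v_i}\}$ is either $\{\overline{vx}: x\in X\cup X^{-1}, v\cdot x\}$ or $\{\overline{xv}: x\in X\cup X^{-1}, x\cdot v\}$, and each is compatible with $\overline u\to\varphi(\overline v)$ via the evident inclusion $\overline v\to\overline{v_i}$. A full set is minimal if it does not contain a full paradigm. Every u-word $u$ has a unique finite minimal full set of ideal preimages with respect to $\varphi$; $S_{u,\varphi}$ denotes the multiset of base words of its elements. It satisfies $|\mathrm{Hom}(u,\varphi(w))|=\sum_{v\in S_{u,\varphi}}|\mathrm{Hom}(v,w)|$ for every cyclic word $w$, where $\mathrm{Hom}$ denotes the set of labeled graph morphisms.
   Formalization: The case n = 1 is excluded: there the claim fails, since the identity and inversion of F_1 lie in different outer classes but give S_{u,φ} = {u} for every unoriented word u. *)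

(* Defs.v *)
From HB Require Import structures.
From mathcomp Require Import all_boot boolp.

Set Implicit Arguments.
Unset Strict Implicit.
Unset Printing Implicit Defensive.

Local Open Scope group_scope.
Local Open Scope quotient_scope.

(******************************************************************************)
(* The free group F_n, as the group of reduced words over X u X^-1, where     *)
(* X = 'I_n; (x, true) stands for x and (x, false) for x^-1.                  *)
(******************************************************************************)

Definition letter (n : nat) : Type := ('I_n * bool)%type.

Definition linv n (a : letter n) : letter n := (a.1, ~~ a.2).

Definition winv n (s : seq (letter n)) := rev (map (@linv n) s).

Definition reduced n (s : seq (letter n)) : bool :=
  sorted (fun a b => b != linv a) s.

(* nonempty, and all cyclic permutations are reduced *)
Definition cyc_reduced n (s : seq (letter n)) : bool :=
  (s != [::]) && cycle (fun a b => b != linv a) s.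

Definition push n (a : letter n) (s : seq (letter n)) :=
  if s is b :: t then if b == linv a then t else a :: s else [:: a].

Record fgroup (n : nat) :=
  FWord { fword :> seq (letter n); fwordP : reduced fword }.
HB.instance Definition _ n := [isSub for @fword n].
HB.instance Definition _ n := [Choice of fgroup n by <:].

Section FreeGroup.
Variable n : nat.
Implicit Types (a b : letter n) (s t : seq (letter n)).

Lemma linvK : involutive (@linv n).
Proof. by case=> x b; rewrite /linv /= negbK. Qed.

Lemma linv_neq a : linv a != a.
Proof. by case: a => x []; rewrite /linv xpair_eqE eqxx. Qed.

Lemma reduced_behead a s : reduced (a :: s) -> reduced s.
Proof. by case: s => //= b s /andP[]. Qed.

Lemma reduced_push a s : reduced s -> reduced (push a s).
Proof.
case: s => //= b s rs; case: ifP => [_|/negbT ne].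
  exact: reduced_behead rs.
by rewrite /reduced /= ne.
Qed.

Lemma push_reduced a s : reduced (a :: s) -> push a s = a :: s.
Proof. by case: s => //= b s /andP[/negbTE->]. Qed.

Lemma pushK a s : reduced s -> push a (push (linv a) s) = s.
Proof.
case: s => [|b s] rs; first by rewrite /= eqxx.
rewrite /= linvK; case: eqP => [e|_]; last by rewrite /= eqxx.
by rewrite -e push_reduced.
Qed.

Lemma reduced_foldr s t : reduced t -> reduced (foldr (@push n) t s).
Proof. by move=> rt; elim: s => //= a s; apply: reduced_push. Qed.

Lemma foldr_push_id s : reduced s -> foldr (@push n) [::] s = s.
Proof.
elim: s => //= a s IH rs; rewrite IH; last exact: reduced_behead rs.
exact: push_reduced.
Qed.

Lemma foldr_pushA s t : reduced t ->
  forall a, foldr (@push n) t (push a s) = push a (foldr (@push n) t s).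
Proof.
move=> rt a; case: s => //= b s; case: eqP => // ->.
by rewrite pushK // reduced_foldr.
Qed.

Lemma reduced_winv s : reduced s -> reduced (winv s).
Proof.
rewrite /reduced /winv rev_sorted sorted_map => /sub_sorted; apply => a b /=.
by apply: contra => /eqP ->; rewrite linvK.
Qed.

Definition fone : fgroup n := @FWord n [::] isT.
Definition finv (u : fgroup n) : fgroup n := FWord (reduced_winv (fwordP u)).
(* the reduced form of the concatenation of u and v *)
Definition fmul (u v : fgroup n) : fgroup n :=
  FWord (reduced_foldr u (fwordP v)).

Lemma fmulA : associative fmul.
Proof.
move=> u v w; apply: val_inj => /=.
elim: (fword u) => //= a s ->.
by rewrite foldr_pushA // fwordP.
Qed.

Lemma fmul1 : left_id fone fmul.
Proof. by move=> u; apply: val_inj. Qed.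

Lemma fmulg1 : right_id fone fmul.
Proof. by move=> u; apply: val_inj; rewrite /= foldr_push_id // fwordP. Qed.

Lemma winvK s : winv (winv s) = s.
Proof. by rewrite /winv map_rev revK -map_comp map_id_in // => a _ /=; rewrite linvK. Qed.

Lemma finvK : involutive finv.
Proof. by move=> u; apply: val_inj; rewrite /= winvK. Qed.

Lemma fmulV : left_inverse fone finv fmul.
Proof.
move=> u; apply: val_inj => /=.
elim: (fword u) (fwordP u) => //= a s IH rs.
rewrite /winv /= rev_cons foldr_rcons /= linvK eqxx IH //.
exact: reduced_behead rs.
Qed.

Lemma fmulgV : right_inverse fone finv fmul.
Proof. by move=> u; rewrite -{1}[u]finvK fmulV. Qed.

End FreeGroup.

HB.instance Definition _ n := isGroup.Build (fgroup n)
  (@fmulA n) (@fmul1 n) (@fmulg1 n) (@fmulV n) (@fmulgV n).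

Definition gen n (a : letter n) : fgroup n := @FWord n [:: a] isT.

Lemma gen_linv n (a : letter n) : gen (linv a) = (gen a)^-1.
Proof. exact: val_inj. Qed.

Record aut (n : nat) := Aut {
  aut_mor :> {multiplicative fgroup n -> fgroup n};
  aut_bij : bijective aut_mor
}.

Lemma aut1 n (phi : aut n) : phi 1 = 1.
Proof. by apply: (mulgI (phi 1)); rewrite mulg1 -gmulfM mulg1. Qed.

Lemma autV n (phi : aut n) x : phi x^-1 = (phi x)^-1.
Proof. by apply: (mulgI (phi x)); rewrite mulgV -gmulfM mulgV aut1. Qed.

(* phi and psi represent the same class in Out(F_n) *)
Definition same_outer n (phi psi : aut n) : Prop :=
  exists g : fgroup n, forall x, psi x = (phi x) ^ g.

(* one step of cyclic reduction: a s a^-1 becomes s *)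
Definition strip n (s : seq (letter n)) :=
  if s is a :: t then if last a t == linv a then take (size t).-1 t else s
  else [::].

Definition cycred n (s : seq (letter n)) := iter (size s) (@strip n) s.

(******************************************************************************)
(* X-labeled Serre graphs.  The label map is the edge part of the morphism to *)
(* the one-vertex graph R_X; lab_einv forces einv to have no fixed point.     *)
(******************************************************************************)

Record lgraph (n : nat) := LGraph {
  vert : choiceType;
  edge : choiceType;
  init : edge -> vert;
  einv : edge -> edge;
  lab : edge -> letter n;
  einvK : involutive einv;
  lab_einv : forall e, lab (einv e) = linv (lab e)
}.

Definition term n (G : lgraph n) (e : edge G) : vert G := init (einv e).

Lemma einv_neq n (G : lgraph n) (e : edge G) : einv e != e.
Proof.
by apply/eqP=> h; have := linv_neq (lab e); rewrite -lab_einv h eqxx.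
Qed.

Definition folded n (G : lgraph n) : Prop :=
  forall e e' : edge G, init e = init e' -> lab e = lab e' -> e = e'.

Record hom n (G H : lgraph n) := Hom {
  hv : vert G -> vert H;
  he : edge G -> edge H;
  hom_init : forall e, init (he e) = hv (init e);
  hom_einv : forall e, he (einv e) = einv (he e);
  hom_lab : forall e, lab (he e) = lab e
}.

Definition hom_eq n (G H : lgraph n) (f g : hom G H) : Prop :=
  hv f =1 hv g /\ he f =1 he g.

Definition hiso n (G H : lgraph n) (f : hom G H) : Prop :=
  bijective (hv f) /\ bijective (he f).

Definition hembed n (G H : lgraph n) (f : hom G H) : Prop :=
  injective (hv f) /\ injective (he f).

Section Comp.
Variables (n : nat) (G H K : lgraph n) (g : hom H K) (f : hom G H).
Definition hcomp : hom G K.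
Proof.
apply: (@Hom n G K (hv g \o hv f) (he g \o he f)) => e /=.
- by rewrite !hom_init.
- by rewrite !hom_einv.
- by rewrite !hom_lab.
Defined.
End Comp.

(******************************************************************************)
(* The segment and the circle labeled by a word s.  The edge (i, true) is the *)
(* i-th edge traversed along s, and (i, false) is its inverse.                *)
(******************************************************************************)

Section WordGraphs.
Variables (n : nat) (s : seq (letter n)).

Definition wlab (e : 'I_(size s) * bool) : letter n :=
  let a := tnth (in_tuple s) e.1 in if e.2 then a else linv a.

Definition winve (e : 'I_(size s) * bool) := (e.1, ~~ e.2).

Lemma winveK : involutive winve.
Proof. by case=> i b; rewrite /winve /= negbK. Qed.

Lemma wlab_inv e : wlab (winve e) = linv (wlab e).
Proof. by case: e => i []; rewrite /wlab /= ?linvK. Qed.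

Definition seg_init (e : 'I_(size s) * bool) : 'I_(size s).+1 :=
  if e.2 then widen_ord (leqnSn _) e.1 else lift ord0 e.1.

Definition circ_init (e : 'I_(size s) * bool) : 'I_(size s) :=
  if e.2 then e.1 else ordS e.1.

Definition seg : lgraph n :=
  @LGraph n 'I_(size s).+1 ('I_(size s) * bool)%type
    seg_init winve wlab winveK wlab_inv.

Definition circ : lgraph n :=
  @LGraph n 'I_(size s) ('I_(size s) * bool)%type
    circ_init winve wlab winveK wlab_inv.

End WordGraphs.

Lemma seg_folded n (s : seq (letter n)) : reduced s <-> folded (seg s).
Proof.
case: s => [|a0 s0].
  by split=> // _ [[]].
set s := a0 :: s0.
have tE (i : 'I_(size s)) : tnth (in_tuple s) i = nth a0 s i by rewrite (tnth_nth a0).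
have W (i j : 'I_(size s)) : reduced s -> i = j.+1 :> nat ->
  nth a0 s i != linv (nth a0 s j).
  move=> /(sortedP a0) h eij; rewrite eij; apply: h; rewrite -eij; exact: ltn_ord.
split=> [rs [i b] [j b'] /= ei | fs].
  move: (congr1 val ei); rewrite /seg_init /wlab /= !tE.
  case: b b' {ei} => -[] /=.
  - by move=> /val_inj->.
  - rewrite /bump leq0n add1n => e l.
    by have := W i j rs e; rewrite l eqxx.
  - rewrite /bump leq0n add1n => e l.
    by have := W j i rs (esym e); rewrite -l eqxx.
  - by rewrite /bump !leq0n !add1n => -[] /val_inj->.
apply/(sortedP a0) => i hi; apply/eqP => e.
have // : (Ordinal hi, true) = (Ordinal (ltnW hi), false).
apply: fs; rewrite /= /seg_init /wlab /= ?tE //.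
exact: val_inj.
Qed.

Lemma circ_folded n (s : seq (letter n)) : cyc_reduced s -> folded (circ s).
Proof.
case: s => // a0 s0 /andP[_]; set s := a0 :: s0 => cs.
have tE (i : 'I_(size s)) : tnth (in_tuple s) i = nth a0 s i by rewrite (tnth_nth a0).
have W (i : 'I_(size s)) : nth a0 s (ordS i) != linv (nth a0 s i).
  move: cs; rewrite /s (cycle_path a0) => /(pathP a0).
  have [e|ne] := eqVneq (val i).+1 (size s).
    move/(_ 0%N isT) => /=; rewrite -/s (_ : i.+1 %% _ = 0)%N; last by rewrite -[X in _ %% X]e modnn.
    by rewrite (last_nth a0); have -> : nth a0 s i = nth a0 s (size s0) by congr nth; case: e.
  have hi : (val i).+1 < size s by rewrite ltn_neqAle ne ltn_ord.
  by move/(_ _ hi) => /=; rewrite modn_small.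
move=> [i b] [j b'] /= ei; rewrite /wlab /= !tE.
move: ei; rewrite /circ_init; case: b b' => -[] /= ei.
- by rewrite ei.
- by rewrite ei => l; have := W j; rewrite l eqxx.
- by rewrite -ei => l; have := W i; rewrite -l eqxx.
- by rewrite (ordS_inj ei).
Qed.

(******************************************************************************)
(* Folding.  vfold is the identification of vertices produced by all possible *)
(* folds: once the initial vertices of two edges with the same label have     *)
(* been identified, so are the edges and their terminal vertices.             *)
(******************************************************************************)

Inductive vfold n (G : lgraph n) : vert G -> vert G -> Prop :=
| vfold_refl x : vfold x x
| vfold_sym x y : vfold x y -> vfold y x
| vfold_trans x y z : vfold x y -> vfold y z -> vfold x z
| vfold_step (e e' : edge G) :
    vfold (init e) (init e') -> lab e = lab e' -> vfold (term e) (term e').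

Definition efold n (G : lgraph n) (e e' : edge G) : Prop :=
  vfold (init e) (init e') /\ lab e = lab e'.

Section Fold.
Variables (n : nat) (G : lgraph n).

Definition vfoldb : rel (vert G) := fun x y => `[< vfold x y >].
Definition efoldb : rel (edge G) := fun e e' => `[< efold e e' >].

Lemma vfoldb_refl : reflexive vfoldb.
Proof. by move=> x; apply/asboolP/vfold_refl. Qed.
Lemma vfoldb_sym : symmetric vfoldb.
Proof. by move=> x y; apply/asboolP/asboolP; apply: vfold_sym. Qed.
Lemma vfoldb_trans : transitive vfoldb.
Proof. by move=> y x z /asboolP xy /asboolP yz; apply/asboolP/(vfold_trans xy). Qed.
Canonical vfold_equiv := EquivRel vfoldb vfoldb_refl vfoldb_sym vfoldb_trans.

Lemma efoldb_refl : reflexive efoldb.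
Proof. by move=> x; apply/asboolP; split=> //; apply: vfold_refl. Qed.
Lemma efoldb_sym : symmetric efoldb.
Proof.
by move=> x y; apply/asboolP/asboolP => -[h l]; split=> //; apply: vfold_sym.
Qed.
Lemma efoldb_trans : transitive efoldb.
Proof.
move=> y x z /asboolP[xy lxy] /asboolP[yz lyz]; apply/asboolP.
by split; [apply: vfold_trans xy yz | rewrite lxy].
Qed.
Canonical efold_equiv := EquivRel efoldb efoldb_refl efoldb_sym efoldb_trans.

Definition fvert := {eq_quot vfold_equiv}.
Definition fedge := {eq_quot efold_equiv}.

Definition vproj (x : vert G) : fvert := \pi_{eq_quot vfold_equiv} x.
Definition eproj (e : edge G) : fedge := \pi_{eq_quot efold_equiv} e.

Lemma vprojP x y : vproj x = vproj y <-> vfold x y.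
Proof.
by split=> [/eqmodP/asboolP //|h]; apply/eqmodP/asboolP.
Qed.

Lemma eprojP e e' : eproj e = eproj e' <-> efold e e'.
Proof.
by split=> [/eqmodP/asboolP //|h]; apply/eqmodP/asboolP.
Qed.

Lemma vreprK (x : fvert) : vproj (repr x) = x.
Proof. exact: reprK. Qed.
Lemma ereprK (e : fedge) : eproj (repr e) = e.
Proof. exact: reprK. Qed.

Lemma efold_einv (e e' : edge G) : efold e e' -> efold (einv e) (einv e').
Proof. by case=> h l; split; [apply: vfold_step | rewrite !lab_einv l]. Qed.

Definition finit (e : fedge) : fvert := vproj (init (repr e)).
Definition feinv (e : fedge) : fedge := eproj (einv (repr e)).
Definition flab (e : fedge) : letter n := lab (repr e).

Lemma efold_repr (e : edge G) : efold (repr (eproj e)) e.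
Proof. by apply/eprojP; rewrite ereprK. Qed.

Lemma feinvE (e : edge G) : feinv (eproj e) = eproj (einv e).
Proof. by apply/eprojP/efold_einv/efold_repr. Qed.
Lemma finitE (e : edge G) : finit (eproj e) = vproj (init e).
Proof. by apply/vprojP; case: (efold_repr e). Qed.
Lemma flabE (e : edge G) : flab (eproj e) = lab e.
Proof. by case: (efold_repr e). Qed.

Lemma feinvK : involutive feinv.
Proof. by move=> e; rewrite -[e]ereprK !feinvE einvK. Qed.
Lemma flab_einv e : flab (feinv e) = linv (flab e).
Proof. by rewrite -[e]ereprK feinvE !flabE lab_einv. Qed.

Definition fold : lgraph n :=
  @LGraph n fvert fedge finit feinv flab feinvK flab_einv.

Lemma fold_folded : folded fold.
Proof.
move=> e e'; rewrite -[e]ereprK -[e']ereprK /= !finitE !flabE => h l.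
by apply/eprojP; split=> //; apply/vprojP.
Qed.

End Fold.

Section FoldMap.
Variables (n : nat) (G H : lgraph n) (f : hom G H).

Lemma vfold_hom x y : vfold x y -> vfold (hv f x) (hv f y).
Proof.
elim=> {x y} [x|x y _|x y z _ + _|e e' _ h l]; first exact: vfold_refl.
- exact: vfold_sym.
- exact: vfold_trans.
- rewrite -[X in vfold X _]hom_init -[X in vfold _ X]hom_init !hom_einv;
  apply: vfold_step; last by rewrite !hom_lab.
  by rewrite !hom_init.
Qed.

Lemma efold_hom (e e' : edge G) : efold e e' -> efold (he f e) (he f e').
Proof. by case=> h l; split; rewrite ?hom_lab // !hom_init; apply: vfold_hom. Qed.

Definition fold_hv (x : vert (fold G)) : vert (fold H) := vproj (hv f (repr x)).
Definition fold_he (e : edge (fold G)) : edge (fold H) := eproj (he f (repr e)).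

Lemma fold_hvE (x : vert G) : fold_hv (vproj x) = vproj (hv f x).
Proof. by apply/vprojP/vfold_hom/vprojP; rewrite vreprK. Qed.
Lemma fold_heE (e : edge G) : fold_he (eproj e) = eproj (he f e).
Proof. exact/eprojP/efold_hom/efold_repr. Qed.

Definition fold_hom : hom (fold G) (fold H).
Proof.
apply: (@Hom n _ _ fold_hv fold_he) => e; rewrite -[e]ereprK /=.
- by rewrite fold_heE !finitE fold_hvE hom_init.
- by rewrite feinvE !fold_heE feinvE hom_einv.
- by rewrite fold_heE !flabE hom_lab.
Defined.

End FoldMap.

(******************************************************************************)
(* The graph F_phi(G): every edge e is replaced by a path labeled by          *)
(* phi(lab e) (which is nonempty, as phi is injective).  The edge (e, i) is   *)
(* the i-th edge of the path replacing e.  As e and its inverse are replaced  *)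
(* by the same path, traversed in opposite directions, the inner vertices of  *)
(* this path are named after the one of the two whose label is in X.          *)
(******************************************************************************)

Section Subdivide.
Variables (n : nat) (phi : aut n).

Definition limg (a : letter n) : seq (letter n) := phi (gen a).

Lemma limg_linv a : limg (linv a) = winv (limg a).
Proof. by rewrite /limg gen_linv autV. Qed.

Lemma size_limg_linv a : size (limg (linv a)) = size (limg a).
Proof. by rewrite limg_linv /winv size_rev size_map. Qed.

Section Graph.
Variable G : lgraph n.

Definition is_inner (p : edge G * nat) : bool :=
  (lab p.1).2 && (0 < p.2 < size (limg (lab p.1))).
Definition is_sedge (p : edge G * nat) : bool := p.2 < size (limg (lab p.1)).

Definition svert : choiceType := (vert G + {p | is_inner p})%type.
Definition sedge : choiceType := {p | is_sedge p}.

(* the vertex at distance i from the origin of the path replacing e *)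
Definition svertex (e : edge G) (i : nat) : svert :=
  let p := if (lab e).2 then (e, i) else (einv e, size (limg (lab e)) - i) in
  if insub p is Some q then inr q
  else inl (if i == 0 then init e else term e).

Definition sinit (d : sedge) : svert := svertex (val d).1 (val d).2.

Lemma sedge_inv_subproof (d : sedge) :
  is_sedge (einv (val d).1,
            (size (limg (lab (val d).1))).-1 - (val d).2).
Proof.
case: d => -[e i] h; rewrite /is_sedge /= lab_einv size_limg_linv.
move: h; rewrite /is_sedge /=; case: (size _) => // m _.
by rewrite ltnS leq_subr.
Qed.
Definition seinv (d : sedge) : sedge := exist (fun p => is_true (is_sedge p)) _ (sedge_inv_subproof d).

Definition slab (d : sedge) : letter n :=
  nth (lab (val d).1) (limg (lab (val d).1)) (val d).2.

Lemma seinvK : involutive seinv.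
Proof.
case=> -[e i] h; apply: val_inj => /=; rewrite einvK lab_einv size_limg_linv.
congr (_, _); move: h; rewrite /is_sedge /=; case: (size _) => // m.
by rewrite ltnS => /subKn.
Qed.

Lemma slab_einv d : slab (seinv d) = linv (slab d).
Proof.
case: d => -[e i] h; rewrite /slab /= lab_einv limg_linv /winv.
move: h; rewrite /is_sedge /= => h.
rewrite nth_rev size_map; last by case: (size _) h => // m _; rewrite ltnS leq_subr.
have -> : size (limg (lab e)) - ((size (limg (lab e))).-1 - i).+1 = i.
  by case: (size _) h => // m; rewrite ltnS subSS => /subKn.
by rewrite (nth_map (lab e)).
Qed.

Definition subdiv : lgraph n :=
  @LGraph n svert sedge sinit seinv slab seinvK slab_einv.

(* consecutive edges of the path replacing an edge share an endpoint *)
Lemma term_sedge (d : edge subdiv) : term d = svertex (val d).1 (val d).2.+1.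
Proof.
case: d => -[e i] h; rewrite /term /= /sinit /svertex /= lab_einv size_limg_linv.
move: h; rewrite /is_sedge /=; set m := size _ => h.
have -> : m - (m.-1 - i) = i.+1 by rewrite -subn1 -subnDA add1n subKn.
have -> : m.-1 - i = m - i.+1 by rewrite -subn1 -subnDA add1n.
rewrite /linv /= einvK if_neg.
have top : ~~ (0 < m - i.+1 < m) -> m - i.+1 == 0.
  by case: posnP => [->|_] //=; rewrite ltn_subrL /= (leq_ltn_trans _ h).
case: ifP => le; case: insubP => // hin; rewrite top // ; move: hin;
  rewrite /is_inner /= ?lab_einv ?size_limg_linv -/m /= le //=.
by rewrite subn_gt0; apply: contra => /andP[].
Qed.

End Graph.

Section Map.
Variables (G H : lgraph n) (f : hom G H).

Lemma is_inner_hom p : is_inner p -> is_inner (he f p.1, p.2).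
Proof. by rewrite /is_inner /= hom_lab. Qed.
Lemma is_sedge_hom p : is_sedge p -> is_sedge (he f p.1, p.2).
Proof. by rewrite /is_sedge /= hom_lab. Qed.

Definition subdiv_hv (x : vert (subdiv G)) : vert (subdiv H) :=
  match x with
  | inl y => inl (hv f y)
  | inr q => inr (exist (fun p => is_true (is_inner p)) _ (is_inner_hom (valP q)))
  end.
Definition subdiv_he (d : edge (subdiv G)) : edge (subdiv H) :=
  exist (fun p => is_true (is_sedge p)) _ (is_sedge_hom (valP d)).

Lemma svertex_hom (e : edge G) i :
  svertex (he f e) i = subdiv_hv (svertex e i).
Proof.
rewrite /svertex hom_lab.
set p := (if _ then (e, _) else _); set q := (if _ then (he f e, _) else _).
have -> : q = (he f p.1, p.2) by rewrite /p /q; case: ifP; rewrite ?hom_einv.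
have E : is_inner (he f p.1, p.2) = is_inner p by rewrite /is_inner /= hom_lab.
case: insubP => [u hu eu|hu]; case: insubP => [v hp ev|hp].
- by congr inr; apply: val_inj; rewrite eu /= ev.
- by rewrite E (negbTE hp) in hu.
- by rewrite E hp in hu.
- by congr inl; case: ifP; rewrite ?hom_init // /term -hom_einv hom_init.
Qed.

Definition subdiv_hom : hom (subdiv G) (subdiv H).
Proof.
apply: (@Hom n _ _ subdiv_hv subdiv_he) => d /=.
- by rewrite /sinit svertex_hom.
- by apply: val_inj; rewrite /= hom_einv hom_lab.
- by rewrite /slab /= hom_lab.
Defined.

End Map.

End Subdivide.

(******************************************************************************)
(* u-words and cyclic words.  A u-word is represented by one of its two       *)
(* orientations: an element u != 1 of F_n stands for the labeled graph seg u, *)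
(* and u, u' represent the same u-word iff u' is u or u^-1.  A cyclic word is *)
(* represented by a cyclically reduced w, and stands for circ w.              *)
(******************************************************************************)

Definition same_uword n (u v : fgroup n) : bool := (u == v) || (u == v^-1).

Section Preimages.
Variables (n : nat) (phi : aut n).
Implicit Types u v w : fgroup n.

Definition tF (G : lgraph n) : lgraph n := fold (subdiv phi G).

Definition tF_hom (G H : lgraph n) (f : hom G H) : hom (tF G) (tF H) :=
  fold_hom (subdiv_hom phi f).

(* the image in tF G of a vertex of G *)
Definition tF_vertex (G : lgraph n) (x : vert G) : vert (tF G) :=
  vproj (inl x : vert (subdiv phi G)).

(* The inclusion of phi(v) as the segment of tF v joining the images of the   *)
(* endpoints; as tF v is folded, at most one morphism has this property.      *)
Definition seg_incl v (k : hom (seg (phi v)) (tF (seg v))) : Prop :=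
  hv k ord0 = tF_vertex (ord0 : vert (seg v)) /\
  hv k ord_max = tF_vertex (ord_max : vert (seg v)).

(* An inclusion of phi(w) as the embedded circle of tF w.  When phi(w) is a   *)
(* proper power there are several of them, which differ by rotations of the   *)
(* circle phi(w).                                                             *)
Definition circ_incl w (k : hom (circ (cycred (phi w))) (tF (circ w))) : Prop :=
  hembed k.

(* Compatibility of f : u -> phi(v), h : u -> phi(w) and g : v -> w, where    *)
(* the word w has graph W, phi(w) has graph P, and k is the inclusion of      *)
(* phi(w) in tF w.                                                            *)
Definition compatible u v (f : hom (seg u) (seg (phi v)))
    (W P : lgraph n) (k : hom P (tF W)) (h : hom (seg u) P)
    (g : hom (seg v) W) : Prop :=
  exists2 j : hom (seg (phi v)) (tF (seg v)), seg_incl j &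
    hom_eq (hcomp (tF_hom g) (hcomp j f)) (hcomp k h).

Definition compatible_uword u v w (f : hom (seg u) (seg (phi v)))
    (h : hom (seg u) (seg (phi w))) (g : hom (seg v) (seg w)) : Prop :=
  exists2 k : hom (seg (phi w)) (tF (seg w)), seg_incl k & compatible f k h g.

Record ideal_preimage u := IdealPreimage {
  base : fgroup n;
  base_neq1 : base != 1;
  pmap : hom (seg u) (seg (phi base));
  pmap_ideal : forall w, w != 1 -> forall g : hom (seg base) (seg w),
    exists h : hom (seg u) (seg (phi w)), compatible_uword pmap h g
}.

(* equality of ideal preimages, base words being taken up to isomorphism *)
Definition same_preimage u (p q : ideal_preimage u) : Prop :=
  exists2 g : hom (seg (base p)) (seg (base q)), hiso g &
    compatible_uword (pmap p) (pmap q) g.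

(* A finite set of ideal preimages is a family indexed by some 'I_k, without  *)
(* repetition.                                                                *)
Definition preimage_set u k (S : 'I_k -> ideal_preimage u) : Prop :=
  forall i j, same_preimage (S i) (S j) -> i = j.

Definition full_set u k (S : 'I_k -> ideal_preimage u) : Prop :=
  preimage_set S /\
  forall w, cyc_reduced w ->
  forall c : hom (circ (cycred (phi w))) (tF (circ w)), circ_incl c ->
  forall h : hom (seg u) (circ (cycred (phi w))),
  exists! i, exists g : hom (seg (base (S i))) (circ w),
    compatible (pmap (S i)) c h g.

(* p is, up to the choice of the representative of its base word, a morphism  *)
(* u -> phi(v') compatible with f : u -> phi(v) via e : v -> v'.              *)
Definition compatible_along u v v' (f : hom (seg u) (seg (phi v)))
    (e : hom (seg v) (seg v')) (p : ideal_preimage u) : Prop :=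
  exists2 g : hom (seg v') (seg (base p)), hiso g &
    compatible_uword f (pmap p) (hcomp g e).

(* The evident inclusions of v in v.x and x.v are the morphisms matching the  *)
(* origins, resp. the ends, of these words.                                   *)
Definition contains_full_paradigm u k (S : 'I_k -> ideal_preimage u) : Prop :=
  exists v, exists2 f : hom (seg u) (seg (phi v)), v != 1 &
    (forall x : letter n, size (v * gen x) = (size v).+1 ->
       exists i, exists2 e : hom (seg v) (seg (v * gen x)),
         hv e ord0 = ord0 & compatible_along f e (S i)) \/
    (forall x : letter n, size (gen x * v) = (size v).+1 ->
       exists i, exists2 e : hom (seg v) (seg (gen x * v)),
         hv e ord_max = ord_max & compatible_along f e (S i)).

Definition minimal_full_set u k (S : 'I_k -> ideal_preimage u) : Prop :=
  full_set S /\ ~ contains_full_paradigm S.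

(* multiplicity of the u-word v in the multiset of base words of S *)
Definition base_mult u k (S : 'I_k -> ideal_preimage u) v : nat :=
  #|[pred i | same_uword (base (S i)) v]|.

(* M is the multiset S_{u,phi}, given by its multiplicity function *)
Definition is_base_multiset u (M : fgroup n -> nat) : Prop :=
  exists k (S : 'I_k -> ideal_preimage u),
    minimal_full_set S /\ forall v, M v = base_mult S v.

End Preimages.

(* Main.v *)
From HB Require Import structures.
Require Import Defs.
From mathcomp Require Import all_boot boolp zify.

(** The proof moves the whole statement into the Cayley tree of F_n.  In a folded
graph a reduced word is read along at most one path from a given vertex, so a
morphism from seg u to a folded graph G is a vertex of G from which u can be
read.  Developing tF phi (seg v) and tF phi (circ w) in F_n ([tF_dev]) turns
compatibility into an equation between elements of F_n ([compatible_uwordP]),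
respectively between cosets of the group generated by w ([circle_axis]).  An
ideal preimage of u becomes an unordered pair of distinct vertices a, b of the
tree such that every segment [A, B] containing [a, b] has
[phi A, phi B] containing [1, u]: see [force], [ideal_force], [force_ideal].  A
cyclic word in which u occurs after applying phi becomes a translate of the
axis of w whose image has an axis through [1, u].

Existence of a minimal full set.  For R large enough, the first size u letters
of phi x, for x outside the ball of radius R, depend only on the first R
letters of x ([stable_radius]).  Whether a line crosses to the other side of
[1, u] is therefore decided by the two points where it meets the sphere of
radius R, and the segments with both ends on that sphere that cross [1, u] form
a full set ([full_list_exists]).  Replacing a full paradigm by the segment that
it extends keeps the set full and makes it smaller, because a vertex has at
least three continuations when n > 1 ([reduce_paradigm]); so a full set without
full paradigm exists ([minimal_full_set_exists]).

Distinguishing phi from psi.  If S_{u,phi} = S_{u,psi} and u occurs in phi w,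
then the full set for phi provides a base word occurring in w, the same base
word belongs to an ideal preimage for psi, and u occurs in psi w
([ideal_readable]).  It thus suffices to find w and u such that u occurs in
phi w and not in psi w; u is taken to be a large power of the cyclic reduction c
of phi w.  If it always occurred in psi w, then by the pigeonhole principle
some power of c would be conjugate to a power of psi w
([power_read_conj]), so theta = psi^-1 phi would send every w to an element
having a power conjugate to a power of w.  Such a theta is inner
([theta_inner]): the axis of theta w is then a translate of that of w.  For a
generator x this gives theta x = r x^k r^-1 with k nonzero; for the products
x y of two generators it forces all exponents to be the same sign, 1 or -1, and
the conjugators to agree; the word x y x^2 y^2, which is not its own mirror
image, excludes the sign -1. *)

Set Implicit Arguments.
Unset Strict Implicit.
Unset Printing Implicit Defensive.

Local Open Scope group_scope.

(** * Reduced words and segments of the Cayley tree *)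

Section Words.
Variable n : nat.
Implicit Types (a b : letter n) (s t m : seq (letter n)) (x y z p q : fgroup n).

Lemma fwordV x : fword x^-1 = winv x.
Proof. by []. Qed.

Lemma fword_inj : injective (@fword n).
Proof. exact: val_inj. Qed.

Lemma size_winv s : size (winv s) = size s.
Proof. by rewrite /winv size_rev size_map. Qed.

Lemma sizeV x : size x^-1 = size x.
Proof. exact: size_winv. Qed.

Lemma winv_cat s t : winv (s ++ t) = winv t ++ winv s.
Proof. by rewrite /winv map_cat rev_cat. Qed.

Lemma winv_rcons s a : winv (rcons s a) = linv a :: winv s.
Proof. by rewrite -cats1 winv_cat. Qed.

Lemma size0_eq1 x : size x = 0 -> x = 1.
Proof. by move/size0nil => e; apply: fword_inj; rewrite e. Qed.

Lemma size_gt0 x : (0 < size x) = (x != 1).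
Proof.
apply/idP/idP => [|ne]; first by apply: contraTneq => ->.
by rewrite lt0n; apply: contra ne => /eqP/size0_eq1/eqP.
Qed.

(** True also when one of the words is empty: the condition for winv s ++ t to
have no cancellation at the junction. *)
Definition diverge s t :=
  if s is a :: _ then (if t is b :: _ then a != b else true) else true.

Lemma divergeC s t : diverge s t = diverge t s.
Proof. by case: s t => [|a s] [|b t] //=; rewrite eq_sym. Qed.

Lemma reduced_cat s t :
  reduced (s ++ t) = [&& reduced s, reduced t & diverge (winv s) t].
Proof.
case/lastP: s => [|s a]; first by rewrite andbT.
case: t => [|b t]; first by rewrite cats0 winv_rcons /= andbT.
rewrite winv_rcons /= cat_rcons /reduced.
case: s => [|c s] /=; first by rewrite eq_sym andbC.
rewrite cat_path rcons_path /= [linv a == b]eq_sym.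
by case: (path _ c s) => //=; case: (a != _) => //=; rewrite andbC.
Qed.

Lemma reduced_catl s t : reduced (s ++ t) -> reduced s.
Proof. by rewrite reduced_cat => /andP[]. Qed.

Lemma reduced_catr s t : reduced (s ++ t) -> reduced t.
Proof. by rewrite reduced_cat => /and3P[]. Qed.

Lemma reduced_winvE s : reduced (winv s) = reduced s.
Proof. by apply/idP/idP => /reduced_winv //; rewrite winvK. Qed.

Lemma diverge_reduced s t : reduced s -> reduced t -> diverge s t -> reduced (winv s ++ t).
Proof. by move=> rs rt d; rewrite reduced_cat winvK reduced_winvE rs rt. Qed.

(** Cancellation is local, so two reduced overlapping words can be glued along a
nonempty overlap. *)
Lemma reduced_glue s t m : t != [::] -> reduced (s ++ t) -> reduced (t ++ m) ->
  reduced ((s ++ t) ++ m).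
Proof.
rewrite ![reduced (_ ++ m)]reduced_cat winv_cat => t0 -> /and3P[_ -> /=].
have : winv t != [::] by rewrite -size_eq0 size_winv size_eq0.
by case: (winv t).
Qed.

Lemma conjX (x y : fgroup n) k : (x * y * x^-1) ^+ k = x * y ^+ k * x^-1.
Proof.
elim: k => [|k IH]; first by rewrite !expg0 mulg1 mulgV.
by rewrite !expgS IH !mulgA mulgVK.
Qed.

(** The product in F_n of the letters of an arbitrary, possibly unreduced word. *)
Definition wprod s : fgroup n := @FWord n _ (reduced_foldr s (isT : reduced (@nil (letter n)))).

Lemma fword_wprod s : reduced s -> fword (wprod s) = s.
Proof. exact: foldr_push_id. Qed.

Lemma wprodK x : wprod x = x.
Proof. by apply: fword_inj; rewrite fword_wprod // fwordP. Qed.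

Lemma wprod_cons a s : wprod (a :: s) = gen a * wprod s.
Proof. exact: fword_inj. Qed.

Lemma wprod_nil : wprod [::] = 1.
Proof. exact: fword_inj. Qed.

Lemma wprod_cat s t : wprod (s ++ t) = wprod s * wprod t.
Proof.
elim: s => [|a s IH]; first by rewrite wprod_nil mul1g.
by rewrite cat_cons !wprod_cons IH mulgA.
Qed.

Lemma wprod_rcons s a : wprod (rcons s a) = wprod s * gen a.
Proof. by rewrite -cats1 wprod_cat wprod_cons wprod_nil mulg1. Qed.

Lemma wprod1 a : wprod [:: a] = gen a.
Proof. by rewrite wprod_cons wprod_nil mulg1. Qed.

Lemma wprod_winv s : wprod (winv s) = (wprod s)^-1.
Proof.
elim: s => [|a s IH]; first by rewrite wprod_nil invg1; apply: fword_inj.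
by rewrite -cat1s winv_cat !wprod_cat IH invgM wprod1; congr (_ * _); rewrite wprod1 gen_linv.
Qed.

Lemma fwordM_cat x y : reduced (x ++ y) -> fword (x * y) = x ++ y.
Proof. by move=> r; rewrite -[x in LHS]wprodK -[y in LHS]wprodK -wprod_cat fword_wprod. Qed.

Lemma lcpP s t : exists m s' t', [/\ s = m ++ s', t = m ++ t' & diverge s' t'].
Proof.
elim: s t => [|a s IH] [|b t]; try by exists [::], [::], [::].
- by exists [::], [::], (b :: t).
- by exists [::], (a :: s), [::].
case: (eqVneq a b) => [<-|ne]; last by exists [::], (a :: s), (b :: t).
case: (IH t) => m [s' [t' [-> -> d]]].
by exists (a :: m), s', t'.
Qed.

(** In x^-1 y exactly the longest common prefix of x and y cancels. *)
Lemma mulVwP x y : exists m s t,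
  [/\ fword x = m ++ s, fword y = m ++ t, fword (x^-1 * y) = winv s ++ t & diverge s t].
Proof.
case: (lcpP x y) => m [s [t [ex ey d]]]; exists m, s, t; split=> //.
have -> : x^-1 * y = wprod (winv s ++ t).
  by rewrite -[x]wprodK -[y]wprodK ex ey !wprod_cat wprod_winv invgM -mulgA mulKg.
rewrite fword_wprod // diverge_reduced //.
- by move: (fwordP x); rewrite ex => /reduced_catr.
- by move: (fwordP y); rewrite ey => /reduced_catr.
Qed.

Lemma mulwP x y : exists s t c,
  [/\ fword x = s ++ c, fword y = winv c ++ t & fword (x * y) = s ++ t].
Proof.
case: (mulVwP x^-1 y) => m [s [t [ex ey exy _]]].
exists (winv s), t, (winv m); split; last by rewrite -exy invgK.
- by rewrite -winv_cat -ex fwordV winvK.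
- by rewrite winvK.
Qed.

Lemma sizeM x y : size (x * y) <= size x + size y.
Proof.
case: (mulwP x y) => s [t [c [-> -> ->]]]; rewrite !size_cat size_winv; lia.
Qed.

Lemma fwordM_size x y : size (x * y) = (size x + size y)%N -> fword (x * y) = x ++ y.
Proof.
case: (mulwP x y) => s [t [c [-> -> ->]]]; rewrite !size_cat size_winv => h.
have /size0nil -> : size c = 0 by lia.
by rewrite cats0.
Qed.

(** Multiplying by y on the right changes at most the last size y letters. *)
Lemma take_mul k x y : k + size y <= size x -> take k (x * y) = take k x.
Proof.
case: (mulwP x y) => s [t [c [-> -> ->]]]; rewrite !size_cat size_winv => h.
by rewrite !takel_cat //; lia.
Qed.

Lemma mulV_chain x y z : (x^-1 * y) * (y^-1 * z) = x^-1 * z.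
Proof. by rewrite mulgA mulgK. Qed.

Lemma triangle x y z : size (x^-1 * z) <= size (x^-1 * y) + size (y^-1 * z).
Proof. by rewrite -(mulV_chain x y z) sizeM. Qed.

(** The vertex x of the Cayley tree lies on the geodesic from p to q.  The
metric form is symmetric in p and q and invariant under left translations. *)
Definition between p q x := size (p^-1 * x) + size (x^-1 * q) == size (p^-1 * q).

Lemma size_mulVC x y : size (x^-1 * y) = size (y^-1 * x).
Proof. by rewrite -sizeV invgM invgK. Qed.

Lemma between_sym p q x : between p q x = between q p x.
Proof.
by rewrite /between addnC (size_mulVC x q) (size_mulVC p x) (size_mulVC p q).
Qed.

Lemma between_mul g p q x : between (g * p) (g * q) (g * x) = between p q x.
Proof. by rewrite /between !invgM -!mulgA !mulKg. Qed.

Lemma betweenl p q : between p q p.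
Proof. by rewrite /between mulVg. Qed.

Lemma betweenr p q : between p q q.
Proof. by rewrite between_sym betweenl. Qed.

(** When the triangle inequality is an equality nothing cancels. *)
Lemma between_cat p q x : between p q x -> fword (p^-1 * q) = (p^-1 * x) ++ (x^-1 * q).
Proof.
have -> : p^-1 * q = (p^-1 * x) * (x^-1 * q) by rewrite mulgA mulgK.
move/eqP => e; apply: fwordM_size; by rewrite e mulgA mulgK.
Qed.

Lemma cat_between p q s t : fword (p^-1 * q) = s ++ t -> between p q (p * wprod s).
Proof.
move=> e; have r : reduced (s ++ t) by rewrite -e fwordP.
rewrite /between e mulKg fword_wprod ?(reduced_catl r) // size_cat.
have -> : (p * wprod s)^-1 * q = wprod t.
  by rewrite invgM -mulgA -[_ * q]wprodK e wprod_cat mulKg.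
by rewrite fword_wprod ?(reduced_catr r).
Qed.

Lemma between_take p q k : between p q (p * wprod (take k (p^-1 * q))).
Proof. by apply: cat_between (esym (cat_take_drop k _)). Qed.

Lemma between1 p q : between p q 1 = diverge p q.
Proof.
rewrite /between mulg1 invg1 mul1g sizeV.
case: (mulVwP p q) => m [s [t [ep eq -> d]]].
rewrite ep eq !size_cat size_winv.
case: m {ep eq} => [|a m] /=; first by rewrite d !add0n eqxx.
by rewrite eqxx; apply/negbTE/eqP; lia.
Qed.

Lemma diverge_mul p q : diverge p q -> fword (p^-1 * q) = winv p ++ q.
Proof.
by move=> d; rewrite fwordM_cat // diverge_reduced // fwordP.
Qed.

Lemma prefix_fword x y : prefix x y -> fword (x^-1 * y) = drop (size x) y.
Proof.
move/prefixP => [r e].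
have -> : y = x * wprod r by rewrite -[y]wprodK e wprod_cat wprodK.
rewrite mulKg fword_wprod; last by move: (fwordP y); rewrite e => /reduced_catr.
rewrite -[x in x * wprod r]wprodK -wprod_cat fword_wprod ?drop_size_cat //.
by rewrite -e fwordP.
Qed.

Lemma between1_prefix q x : between 1 q x = prefix x q.
Proof.
apply/idP/idP => [/between_cat|/prefixP[r e]].
  by rewrite invg1 !mul1g => ->; rewrite prefix_prefix.
rewrite -[x]wprodK -[wprod x]mul1g; apply: (@cat_between _ _ _ r).
by rewrite invg1 mul1g.
Qed.

Lemma between_prefixl p q x : diverge p q -> prefix x q -> between p q x.
Proof.
move=> d /[dup] px /prefixP [r e].
rewrite /between (prefix_fword px) (diverge_mul d) size_drop size_cat size_winv.
have /diverge_mul -> : diverge p x.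
  by move: d; rewrite e; case: (fword p) (fword x) => [|a ?] [|b ?].
by rewrite !size_cat !size_winv -addnA subnKC // size_prefix.
Qed.

(** When p and q diverge, the geodesic from p to q runs through 1, so its
vertices are the prefixes of p and those of q. *)
Lemma between_prefix p q x : diverge p q -> between p q x = prefix x p || prefix x q.
Proof.
move=> d; apply/idP/orP; last first.
  case=> px; last exact: between_prefixl.
  by rewrite between_sym; apply: between_prefixl => //; rewrite divergeC.
move/between_cat; rewrite (diverge_mul d) => e.
have ex : x = p * wprod (take (size (p^-1 * x)) (winv p ++ q)).
  by rewrite e take_size_cat // wprodK mulVKg.
move: ex; set k := size (p^-1 * x) => ex.
case: (leqP k (size (winv p))) => h.
  left.
  rewrite takel_cat // in ex.
  have ep : fword p = winv (drop k (winv p)) ++ winv (take k (winv p)).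
    by rewrite -winv_cat cat_take_drop winvK.
  have -> : fword x = winv (drop k (winv p)).
    have pE : p = wprod (winv (drop k (winv p))) / wprod (take k (winv p)).
      by rewrite -wprod_winv -wprod_cat -ep wprodK.
    rewrite ex {1}pE mulgVK fword_wprod //.
    by apply: (@reduced_catl _ (winv (take k (winv p)))); rewrite -ep fwordP.
  by rewrite [X in prefix _ X]ep prefix_prefix.
right; rewrite ex take_cat (leq_gtF (ltnW h)) wprod_cat wprod_winv wprodK mulgA mulgV mul1g.
by rewrite fword_wprod ?prefix_take // /reduced take_sorted // -/(reduced _) fwordP.
Qed.

End Words.

(** * Walks in labeled graphs, segments and circles *)

Section Walks.
Variable n : nat.
Implicit Types (G H : lgraph n) (s t : seq (letter n)) (p q : fgroup n).

Fixpoint walk G (x : vert G) s (y : vert G) : Prop :=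
  if s is a :: t then exists e, [/\ init e = x, lab e = a & walk (term e) t y]
  else x = y.

Lemma walk_cat G (x z : vert G) s t :
  walk x (s ++ t) z <-> exists y, walk x s y /\ walk y t z.
Proof.
elim: s x => [|a s IH] x /=.
  by split=> [h|[y [->]]] //; exists x.
split=> [[e [ex el /IH[y [h1 h2]]]]|[y [[e [ex el h1]] h2]]].
  by exists y; split=> //; exists e.
by exists e; split=> //; apply/IH; exists y.
Qed.

Lemma term_einv G (e : edge G) : term (einv e) = init e.
Proof. by rewrite /term einvK. Qed.

Lemma walk_winv G (x y : vert G) s : walk x s y -> walk y (winv s) x.
Proof.
elim: s x => [|a s IH] x /=; first by move->.
move=> [e [<- <- /IH h]]; rewrite -cat1s winv_cat; apply/walk_cat.
by exists (term e); split=> //; exists (einv e); rewrite lab_einv term_einv.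
Qed.

Lemma hom_term G H (f : hom G H) e : term (he f e) = hv f (term e).
Proof. by rewrite /term -hom_einv hom_init. Qed.

Lemma walk_hom G H (f : hom G H) (x y : vert G) s :
  walk x s y -> walk (hv f x) s (hv f y).
Proof.
elim: s x => [|a s IH] x /=; first by move->.
move=> [e [<- <- /IH h]]; exists (he f e).
by rewrite hom_init hom_lab hom_term.
Qed.

Section Folded.
Variables (G : lgraph n) (fG : folded G).

Lemma walk_fun (x y z : vert G) s : walk x s y -> walk x s z -> y = z.
Proof.
elim: s x => [|a s IH] x /=; first by move=> <-.
move=> [e [ex el h]] [e' [ex' el' h']].
have ee : e = e' by apply: fG; congruence.
by subst e'; apply: IH h h'.
Qed.

(** In a folded graph, an edge followed by an edge with the inverse label is a
backtracking, which can be deleted. *)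
Lemma walk_push (x y : vert G) a s : walk x (a :: s) y -> walk x (push a s) y.
Proof.
case: s => [|b s] //= [e [ex el h]]; case: eqP => [eb|_]; last by exists e.
case: h => e' [ex' el' h'].
suff ee : e' = einv e by rewrite -ex -term_einv -ee.
by apply: fG => //; rewrite el' eb lab_einv el.
Qed.

Lemma walk_wprod (x y : vert G) s : walk x s y -> walk x (wprod s) y.
Proof.
elim: s x => [|a s IH] x //= [e [ex el /IH h]].
by apply: walk_push; exists e.
Qed.

(** A folded graph carries a partial right action of F_n: walks can be composed
and then reduced. *)
Lemma walkM (x y z : vert G) p q : walk x p y -> walk y q z -> walk x (p * q) z.
Proof.
move=> h1 h2; have -> : p * q = wprod (p ++ q) by rewrite wprod_cat !wprodK.
by apply: walk_wprod; apply/walk_cat; exists y.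
Qed.

Lemma walkV (x y : vert G) p : walk x p y -> walk y p^-1 x.
Proof. exact: walk_winv. Qed.

Lemma walkX (x : vert G) p k : walk x p x -> walk x (p ^+ k) x.
Proof.
by move=> h; elim: k => [|k IH] //; rewrite expgS; apply: walkM h IH.
Qed.

End Folded.

(** The vertices met by a walk; the letter a0 is only a default value for nth. *)
Lemma walk_vs G (x y : vert G) s : walk x s y -> exists vs : nat -> vert G,
  [/\ vs 0 = x, vs (size s) = y & forall a0 i, i < size s ->
      exists e, [/\ init e = vs i, lab e = nth a0 s i & term e = vs i.+1]].
Proof.
elim: s x => [|a s IH] x /=; first by move->; exists (fun=> y).
move=> [e [ex el /IH[vs [v0 vm h]]]].
exists (fun i => if i is j.+1 then vs j else x); split=> // a0 [|i] hi.
  by exists e.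
by have [e' [? ? ?]] := h a0 i hi; exists e'.
Qed.

(** Together with [seg_hom_eq]: morphisms from a segment labeled s to a folded
graph correspond to the vertices from which s can be read. *)
Lemma walk_seg_hom G (x y : vert G) s : walk x s y ->
  exists f : hom (seg s) G, hv f ord0 = x /\ hv f ord_max = y.
Proof.
move/walk_vs => [vs [v0 vm h]].
have : forall i : 'I_(size s), exists e : edge G,
    [/\ init e = vs i, lab e = tnth (in_tuple s) i & term e = vs i.+1].
  move=> i; have [e [h1 h2 h3]] := h (tnth (in_tuple s) i) i (ltn_ord i).
  by exists e; split=> //; rewrite h2 [RHS](tnth_nth (tnth (in_tuple s) i)).
move/choice => [E hE].
pose he (e : 'I_(size s) * bool) := if e.2 then E e.1 else einv (E e.1).
have P1 (e : edge (seg s)) : init (he e) = vs (init e).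
  case: e => i [] /=; rewrite /he /=; first by case: (hE i).
  by rewrite /bump leq0n add1n; case: (hE i) => _ _; rewrite /term.
have P2 (e : edge (seg s)) : he (einv e) = einv (he e).
  by case: e => i []; rewrite /he //= einvK.
have P3 (e : edge (seg s)) : lab (he e) = lab e.
  by case: e => i []; rewrite /he /= /wlab /= ?lab_einv; case: (hE i) => _ ->.
exists (@Hom _ (seg s) G (fun i => vs i) he P1 P2 P3).
by rewrite /= v0 vm.
Qed.

Lemma seg_walk_take s (i : vert (seg s)) : walk (ord0 : vert (seg s)) (take i s) i.
Proof.
case: i => k hk /=.
elim: k hk => [|k IH] hk; first by rewrite take0; apply: val_inj.
have hk' : k < size s by [].
have a0 : letter n by case: (s) hk'.
rewrite (take_nth a0) // -cats1; apply/walk_cat.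
exists (Ordinal (ltnW hk)); split; first exact: IH.
exists (Ordinal hk', true); split.
- exact: val_inj.
- by rewrite /= /wlab /= (tnth_nth a0).
- exact: val_inj.
Qed.

Lemma seg_walk s : walk (ord0 : vert (seg s)) s (ord_max : vert (seg s)).
Proof. by have := @seg_walk_take s ord_max; rewrite take_size. Qed.

Lemma seg_edge s (e : edge (seg s)) :
  wprod (take (init e) s) * gen (lab e) = wprod (take (term e) s).
Proof.
have H (i : 'I_(size s)) : wprod (take i s) * gen (tnth (in_tuple s) i) = wprod (take i.+1 s).
  have a0 : letter n by case: (s) i => [[]|].
  by rewrite (tnth_nth a0) (take_nth a0) // wprod_rcons.
case: e => i [] /=; rewrite /term /= /wlab /= /bump leq0n add1n ?H //.
by rewrite gen_linv -H mulgK.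
Qed.

(** The vertices of a segment, placed in the Cayley tree with origin at 1. *)
Definition pos s (i : 'I_(size s).+1) : fgroup n := wprod (take i s).

Lemma pos0 s (i : vert (seg s)) : i = 0 :> nat -> pos i = 1.
Proof. by rewrite /pos => ->; rewrite take0 wprod_nil. Qed.

Lemma pos_max s : pos (ord_max : vert (seg s)) = wprod s.
Proof. by rewrite /pos take_size. Qed.

Lemma seg_dev s (i j : vert (seg s)) t : walk i t j -> pos i * wprod t = pos j.
Proof.
elim: t i => [|a t IH] i /=; first by move->; rewrite wprod_nil mulg1.
by move=> [e [<- <- /IH <-]]; rewrite wprod_cons mulgA /pos -seg_edge.
Qed.

Lemma seg_walkP s (i j : vert (seg s)) p : reduced s ->
  pos i * p = pos j -> walk i p j.
Proof.
move=> rs e; have fs := iffLR (seg_folded s) rs.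
have h (k : vert (seg s)) : walk (ord0 : vert (seg s)) (pos k) k.
  by apply: walk_wprod => //; apply: seg_walk_take.
have -> : p = (pos i)^-1 * pos j by rewrite -e mulKg.
exact: (walkM fs (walkV (h i)) (h j)).
Qed.

Lemma hom_pos s t (g : hom (seg s) (seg t)) i :
  pos (hv g i) = pos (hv g ord0) * pos i.
Proof.
by rewrite -(seg_dev (walk_hom g (seg_walk_take i))).
Qed.

Lemma seg_hom_hv s G (fG : folded G) (f g : hom (seg s) G) :
  hv f ord0 = hv g ord0 -> hv f =1 hv g.
Proof.
move=> e i; have := walk_hom f (seg_walk_take i); rewrite e.
by move=> h; apply: (walk_fun fG h); apply/walk_hom/seg_walk_take.
Qed.

Lemma seg_hom_eq s G (fG : folded G) (f g : hom (seg s) G) :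
  hv f ord0 = hv g ord0 -> hom_eq f g.
Proof.
move=> /(seg_hom_hv fG) E; split=> // e.
by apply: fG; rewrite ?hom_lab // !hom_init E.
Qed.

(** The cyclic group generated by p. *)
Definition is_power p q := exists k, q = p ^+ k \/ q = p^-1 ^+ k.

Lemma is_power1 p : is_power p 1.
Proof. by exists 0; left. Qed.

Lemma is_power_id p : is_power p p.
Proof. by exists 1%N; left. Qed.

Lemma is_powerV p q : is_power p q -> is_power p q^-1.
Proof.
by move=> [k [->|->]]; exists k; [right|left]; rewrite ?expVgn ?invgK.
Qed.

Lemma is_power_inv p q : is_power p^-1 q <-> is_power p q.
Proof. by split=> -[k [->|->]]; exists k; rewrite ?invgK; [right|left|right|left]. Qed.

Lemma is_powerM p q1 q2 : is_power p q1 -> is_power p q2 -> is_power p (q1 * q2).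
Proof.
have H k l : is_power p (p ^+ k * p^-1 ^+ l).
  rewrite expVgn; case: (leqP l k) => h.
    by exists (k - l)%N; left; rewrite expgnFr.
  exists (l - k)%N; right; rewrite expVgn (expgnFr _ (ltnW h)) invgM invgK //.
have HC k l : p^-1 ^+ l * p ^+ k = p ^+ k * p^-1 ^+ l.
  by apply: commuteX2; apply/commute_sym/commuteV.
move=> [k [->|->]] [l [->|->]]; rewrite ?HC //.
- by exists (k + l)%N; left; rewrite expgnDr.
- by exists (k + l)%N; right; rewrite expgnDr.
Qed.

Section Circ.
Variable w : seq (letter n).
Hypothesis cw : cyc_reduced w.
Let fw := circ_folded cw.

Lemma cyc_size : 0 < size w.
Proof. by case: (w) cw. Qed.

Definition circ_origin : vert (circ w) := Ordinal cyc_size.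

Lemma cyc_red : reduced w.
Proof.
case: (w) cw => // a s; rewrite /cyc_reduced /reduced /= rcons_path.
by case/andP.
Qed.

Lemma fword_cyc : fword (wprod w) = w.
Proof. by rewrite fword_wprod // cyc_red. Qed.

Lemma circ_walk_takeS (k : nat) (i : vert (circ w)) : k <= size w -> i = (k %% size w)%N :> nat ->
  walk circ_origin (take k w) i.
Proof.
elim: k i => [|k IH] i hk ei.
  by rewrite take0; apply: val_inj; rewrite /= ei mod0n.
have a0 : letter n by case: (w) hk.
rewrite (take_nth a0) // -cats1; apply/walk_cat.
exists (Ordinal hk); split; first by apply: IH; rewrite /= ?modn_small // ltnW.
exists (Ordinal hk, true); split=> //.
- by rewrite /= /wlab /= (tnth_nth a0).
- by apply: val_inj; rewrite /= ei.
Qed.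

Lemma circ_walk_take (i : vert (circ w)) : walk circ_origin (take i w) i.
Proof. by apply: circ_walk_takeS; rewrite ?modn_small // ltnW. Qed.

Lemma circ_walk : walk circ_origin w circ_origin.
Proof.
have := @circ_walk_takeS (size w) circ_origin (leqnn _); rewrite take_size; apply.
by rewrite modnn.
Qed.

(** Going through the origin of the circle multiplies the position by w or by
its inverse, so positions on the circle make sense modulo the group generated
by w. *)
Lemma circ_edge (e : edge (circ w)) :
  exists2 h, is_power (wprod w) h &
    wprod (take (init e) w) * gen (lab e) = h * wprod (take (term e) w).
Proof.
have H (i : 'I_(size w)) : exists2 h, is_power (wprod w) h &
    wprod (take i w) * gen (tnth (in_tuple w) i) = h * wprod (take (ordS i) w).
  have a0 : letter n by case: (w) i => [[]|].
  rewrite (tnth_nth a0) -wprod_rcons -(take_nth a0) //=.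
  case: (ltnP i.+1 (size w)) => hi.
    by exists 1; [apply: is_power1 | rewrite modn_small // mul1g].
  have -> : i.+1 = size w by apply/eqP; rewrite eqn_leq hi ltn_ord.
  by exists (wprod w); [apply: is_power_id|rewrite modnn take0 take_size wprod_nil mulg1].
case: e => i [] /=; rewrite /term /= /wlab /=; first exact: H.
have [h ph e] := H i; exists h^-1; first exact: is_powerV.
by rewrite gen_linv; apply: (mulIg (gen (tnth (in_tuple w) i))); rewrite mulgVK -mulgA e mulKg.
Qed.

Lemma circ_dev (i j : vert (circ w)) t : walk i t j ->
  exists2 h, is_power (wprod w) h & wprod (take i w) * wprod t = h * wprod (take j w).
Proof.
elim: t i => [|a t IH] i /=.
  by move->; exists 1; [apply: is_power1|rewrite wprod_nil mulg1 mul1g].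
move=> [e [<- <- /IH[h ph eh]]].
have [h' ph' eh'] := circ_edge e.
exists (h' * h); first exact: is_powerM.
by rewrite wprod_cons mulgA eh' -mulgA eh mulgA.
Qed.

Lemma circ_valence (e1 e2 e3 : edge (circ w)) :
  init e1 = init e3 -> init e2 = init e3 -> e1 <> e3 -> e2 <> e3 -> e1 = e2.
Proof.
case: e1 e2 e3 => [i1 b1] [i2 b2] [i3 b3] /=; rewrite /circ_init /=.
case: b1 b2 b3 => -[] [] //= h1 h2 n1 n2; congr (_, _);
  do ?[by rewrite h1 h2 | by move: h1; rewrite -h2 => /ordS_inj | by case: n1; rewrite h1
     | by case: n2; rewrite h2 | by case: n1; rewrite (ordS_inj h1) | by case: n2; rewrite (ordS_inj h2)].
Qed.

Lemma circ_next (x : vert (circ w)) a : exists e : edge (circ w), init e = x /\ lab e <> a.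
Proof.
have ne : ((x, true) : edge (circ w)) <> (ord_pred x, false) by [].
case: (eqVneq (lab ((x, true) : edge (circ w))) a) => [ea|/eqP nea]; last by exists (x, true).
exists (ord_pred x, false); split; first by rewrite /= /circ_init /= ord_predK.
move=> ea'; apply: ne; apply: fw; last by rewrite ea ea'.
by rewrite /= /circ_init /= ord_predK.
Qed.

(** A reduced walk on a circle never turns back, hence is determined by its
first edge and its length. *)
Lemma circ_prefix (x y z : vert (circ w)) a s t :
  reduced (a :: s) -> reduced (a :: t) -> walk x (a :: s) y -> walk x (a :: t) z ->
  size s <= size t -> prefix s t.
Proof.
elim: s t a x => [|b s IH] [|c t] a x // rs rt.
move=> [e [ex el [e1 [ex1 el1 h1]]]] [e' [ex' el' [e2 [ex2 el2 h2]]]].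
have ee : e = e' by apply: fw; rewrite ?ex ?el.
subst e'.
have E : e1 = e2.
  refine (@circ_valence e1 e2 (einv e) ex1 ex2 _ _) => E.
    by move: rs; rewrite /reduced /= -el1 E lab_einv el eqxx.
  by move: rt; rewrite /reduced /= -el2 E lab_einv el eqxx.
subst e2; rewrite /= ltnS => le; rewrite -el1 -el2 eqxx /=.
apply: (IH _ b (init e1)) => //.
- exact: reduced_behead rs.
- by rewrite -el1 el2; apply: reduced_behead rt.
- by exists e1.
- by exists e1.
Qed.

End Circ.

End Walks.

(** * The graph tF phi G and its development in F_n *)

Definition fproj n (G : lgraph n) : hom G (fold G).
Proof.
apply: (@Hom n G (fold G) (@vproj n G) (@eproj n G)) => e.
- exact: finitE.
- by rewrite /= feinvE.
- exact: flabE.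
Defined.

Section TF.
Variables (n : nat) (phi : aut n).
Implicit Types (G H : lgraph n) (s t : seq (letter n)) (p q : fgroup n).

Lemma aut_inj : injective phi.
Proof. exact: bij_inj (aut_bij phi). Qed.

Lemma autX p k : phi (p ^+ k) = phi p ^+ k.
Proof. by elim: k => [|k IH]; rewrite ?expg0 ?aut1 // !expgS gmulfM IH. Qed.

Lemma limg_gt0 a : 0 < size (limg phi a).
Proof.
rewrite /limg size_gt0 -(aut1 phi) (inj_eq aut_inj).
by apply/eqP => /(congr1 (fun x => size (fword x))).
Qed.

Section Graph.
Variable G : lgraph n.
Local Notation SG := (subdiv phi G).
Local Notation m e := (size (limg phi (lab e))).

Lemma svertex0 (e : edge G) : svertex phi e 0 = inl (init e).
Proof.
rewrite /svertex; case: ifP => le; case: insubP => // q.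
  by rewrite /is_inner /= andbF.
by rewrite /is_inner /= lab_einv size_limg_linv subn0 ltnn !andbF.
Qed.

Lemma svertex_end (e : edge G) : svertex phi e (m e) = inl (term e).
Proof.
rewrite /svertex; case: ifP => le; case: insubP => // q; rewrite ?(gtn_eqF (limg_gt0 _)) //.
  by rewrite /is_inner /= ltnn !andbF.
by rewrite /is_inner /= subnn /= andbF.
Qed.

Lemma subdiv_walk (e : edge G) i : i <= m e ->
  walk (svertex phi e 0 : vert SG) (take i (limg phi (lab e))) (svertex phi e i).
Proof.
elim: i => [|i IH] h; first by rewrite take0.
rewrite (take_nth (lab e)) // -cats1; apply/walk_cat.
exists (svertex phi e i); split; first exact: IH (ltnW h).
by exists (exist _ (e, i) h : edge SG); split; rewrite ?term_sedge.
Qed.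

Lemma tF_edge (e : edge G) :
  walk (tF_vertex phi (init e)) (phi (gen (lab e))) (tF_vertex phi (term e)).
Proof.
have := walk_hom (fproj _) (subdiv_walk (leqnn (m e))).
by rewrite take_size svertex0 svertex_end.
Qed.

Lemma tF_walk (x y : vert G) s : walk x s y ->
  walk (tF_vertex phi x) (phi (wprod s)) (tF_vertex phi y).
Proof.
elim: s x => [|a s IH] x; first by move=> ->; rewrite wprod_nil aut1.
move=> [e [<- <- /IH h]]; rewrite wprod_cons gmulfM.
by apply: walkM (tF_edge e) h; apply: fold_folded.
Qed.

Lemma tF_conn (x : vert G) : (forall y : vert G, exists s, walk x s y) ->
  forall v : vert (tF phi G), exists t : fgroup n, walk (tF_vertex phi x) t v.
Proof.
move=> cG v; rewrite -[v]vreprK.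
case: (repr v) => [y|q].
  by case: (cG y) => s /tF_walk h; exists (phi (wprod s)).
case: q => -[e i] hq.
have [s /tF_walk h] := cG (init e).
have := hq; rewrite /is_inner /= => /and3P[le _ hi].
exists (phi (wprod s) * wprod (take i (limg phi (lab e)))).
apply: walkM h _; first exact: fold_folded.
apply: walk_wprod; first exact: fold_folded.
have := walk_hom (fproj _) (subdiv_walk (ltnW hi)).
rewrite svertex0; have -> // : svertex phi e i = inr (exist _ (e, i) hq).
rewrite /svertex le; case: insubP => [q' _ eq' |]; last by rewrite hq.
by congr inr; apply: val_inj.
Qed.

Section Dev.
Variables (Hs : fgroup n -> Prop) (rho : vert G -> fgroup n).
Hypotheses (H1 : Hs 1) (HM : forall p q, Hs p -> Hs q -> Hs (p * q))
  (HV : forall p, Hs p -> Hs p^-1)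
  (Hrho : forall e, Hs (rho (init e) * gen (lab e) * (rho (term e))^-1)).

Let H' q := exists2 h, Hs h & q = phi h.

Let H'1 : H' 1.
Proof. by exists 1; rewrite ?aut1. Qed.

Let H'M p q : H' p -> H' q -> H' (p * q).
Proof. by move=> [h ? ->] [k ? ->]; exists (h * k); [apply: HM|rewrite gmulfM]. Qed.

Let H'V p : H' p -> H' p^-1.
Proof. by move=> [h ? ->]; exists h^-1; [apply: HV|rewrite autV]. Qed.

(** The map from the subdivision of G to F_n extending phi \o rho on the
vertices of G.  When rho multiplies by the labels modulo Hs, it multiplies by
the labels modulo phi Hs, which is why foldings cannot identify vertices whose
images differ modulo phi Hs. *)
Definition devel (v : vert SG) : fgroup n :=
  match v with
  | inl x => phi (rho x)
  | inr q => phi (rho (init (val q).1)) * wprod (take (val q).2 (limg phi (lab (val q).1)))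
  end.

Let A e i := phi (rho (init e)) * wprod (take i (limg phi (lab e))).

Let devel_svertex e i : i <= m e -> H' (A e i / devel (svertex phi e i)).
Proof.
move=> hi.
have E0 : H' (A e 0 / devel (svertex phi e 0)).
  by rewrite svertex0 /A /= take0 wprod_nil mulg1 mulgV.
have Em : H' (A e (m e) / devel (svertex phi e (m e))).
  rewrite svertex_end /A /= take_size /limg wprodK -autV -!gmulfM.
  by exists (rho (init e) * gen (lab e) / rho (term e)).
case: (posnP i) => [-> //|i0].
move: hi; rewrite leq_eqVlt => /orP[/eqP -> //|hi].
rewrite /svertex; case: ifP => le; case: insubP => /= [q _ eq|].
- by rewrite eq /A /= mulgV.
- by rewrite /is_inner /= le i0 hi.
- rewrite eq /A /= lab_einv limg_linv /winv take_rev size_map subKn; last exact: ltnW.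
  rewrite -map_drop -/(winv _) wprod_winv invgM invgK mulgA -[X in X / _]mulgA -wprod_cat.
  rewrite cat_take_drop /limg wprodK -autV -!gmulfM.
  by exists (rho (init e) * gen (lab e) / rho (term e)).
by rewrite /is_inner /= lab_einv size_limg_linv /linv /= le /= subn_gt0 hi ltn_subrL i0 (ltn_trans i0 hi).
Qed.

Let devel_edge (d : edge SG) : H' (devel (init d) * gen (lab d) / devel (term d)).
Proof.
rewrite term_sedge; case: d => -[e i] h /=.
have h' : i < m e by [].
have h1 := devel_svertex (ltnW h'); have h2 := devel_svertex h'.
move: (H'M (H'V h1) h2); rewrite /A (take_nth (lab e)) // wprod_rcons.
by rewrite !invgM !invgK -!mulgA !mulKg.
Qed.

Let devel_vfold (x y : vert SG) : vfold x y -> H' (devel x / devel y).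
Proof.
elim=> {x y} [x|x y _ h|x y z _ h1 _ h2|e e' _ h l].
- by rewrite mulgV.
- by rewrite -invgF; apply: H'V.
- by rewrite -(divgKA (devel y)); have := H'M h1 h2; rewrite mulgA.
- have := H'M (H'V (devel_edge e)) (H'M h (devel_edge e')).
  by rewrite l !invgM invgK !gnorm.
Qed.

Lemma devel_walk (x y : vert SG) s :
  walk (vproj x : vert (fold SG)) s (vproj y) -> H' (devel x * wprod s / devel y).
Proof.
elim: s x => [|a s IH] x.
  by move/vprojP/devel_vfold; rewrite wprod_nil mulg1.
move=> [e [ex el h]]; have ed : e = he (fproj SG) (repr e) by rewrite /= ereprK.
move: (repr e) ed ex el h => d ->; rewrite hom_init hom_lab hom_term.
move=> /vprojP/devel_vfold hx el /IH h.
have := H'M (H'V hx) (H'M (devel_edge d) h).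
by rewrite wprod_cons el !invgM invgK !gnorm.
Qed.

(** Used with Hs trivial for segments and with the powers of w for the circle of
w. *)
Lemma tF_dev (x y : vert G) p : walk (tF_vertex phi x) p (tF_vertex phi y) ->
  exists2 h, Hs h & phi (rho x) * p = phi h * phi (rho y).
Proof.
move/devel_walk; rewrite wprodK /= => -[h hh e].
by exists h => //; rewrite -e mulgVK.
Qed.

End Dev.

End Graph.

Lemma tF_seg_dev s (i j : vert (seg s)) p :
  walk (tF_vertex phi i) p (tF_vertex phi j) -> phi (pos i) * p = phi (pos j).
Proof.
move/(@tF_dev (seg s) (eq 1) (@pos n s)) => [] //.
- by move=> p' q' <- <-; rewrite mulg1.
- by move=> p' <-; rewrite invg1.
- by move=> e; rewrite /pos seg_edge mulgV.
- by move=> _ <-; rewrite aut1 mul1g.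
Qed.

Lemma tF_circ_dev w (i j : vert (circ w)) p :
  walk (tF_vertex phi i) p (tF_vertex phi j) ->
  exists2 h, is_power (wprod w) h & phi (wprod (take i w)) * p = phi h * phi (wprod (take j w)).
Proof.
apply: (@tF_dev (circ w) (is_power (wprod w)) (fun i : vert (circ w) => wprod (take i w))).
- exact: is_power1.
- exact: is_powerM.
- exact: is_powerV.
- by move=> e; case: (circ_edge e) => h ph ->; rewrite mulgK.
Qed.

Lemma tF_hom_vertex G H (g : hom G H) x :
  hv (tF_hom phi g) (tF_vertex phi x) = tF_vertex phi (hv g x).
Proof. exact: fold_hvE. Qed.

Lemma tF_folded G : folded (tF phi G).
Proof. exact: fold_folded. Qed.

Lemma seg_incl_ex v : exists j : hom (seg (phi v)) (tF phi (seg v)), seg_incl j.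
Proof.
have := tF_walk (seg_walk v); rewrite wprodK => /walk_seg_hom [f [h1 h2]].
by exists f.
Qed.

Lemma seg_incl_pos v (j : hom (seg (phi v)) (tF phi (seg v))) : seg_incl j -> forall i,
  walk (tF_vertex phi (ord0 : vert (seg v))) (pos i) (hv j i).
Proof.
case=> h0 _ i; have := walk_hom j (seg_walk_take i); rewrite h0.
exact/walk_wprod/tF_folded.
Qed.

(** Both composites are morphisms to a folded graph, so they agree as soon as
they send the origin of u to the same vertex. *)
Lemma compatibleP (u v : fgroup n) (f : hom (seg u) (seg (phi v))) W P
  (k : hom P (tF phi W)) (h : hom (seg u) P) (g : hom (seg v) W) :
  compatible f k h g <->
  walk (tF_vertex phi (hv g ord0)) (pos (hv f ord0)) (hv k (hv h ord0)).
Proof.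
have S j : seg_incl j -> walk (tF_vertex phi (hv g ord0)) (pos (hv f ord0))
      (hv (tF_hom phi g) (hv j (hv f ord0))).
  by move=> /seg_incl_pos/(_ (hv f ord0))/(walk_hom (tF_hom phi g)); rewrite tF_hom_vertex.
split=> [[j sj [ev _]]|hw].
  by have := S j sj; move: (ev ord0) => /= ->.
have [j sj] := seg_incl_ex v.
exists j => //; apply: seg_hom_eq; first exact: tF_folded.
by apply: (walk_fun (@tF_folded _) (S j sj)).
Qed.

Lemma compatible_uwordP (u v w : fgroup n) (f : hom (seg u) (seg (phi v)))
    (h : hom (seg u) (seg (phi w))) (g : hom (seg v) (seg w)) :
  compatible_uword f h g <->
  phi (pos (hv g ord0)) * pos (hv f ord0) = pos (hv h ord0).
Proof.
have W := tF_walk (seg_walk_take (hv g ord0)); rewrite -/(pos _) in W.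
split=> [[k sk /compatibleP]|e].
  have h0 := seg_incl_pos sk (hv h ord0).
  move=> h1; have h2 := walkM (@tF_folded _) (walkM (@tF_folded _) W h1) (walkV h0).
  have := tF_seg_dev h2; rewrite pos0 // aut1 mul1g => /eqP.
  by rewrite divg_eq1 => /eqP.
have [k sk] := seg_incl_ex w; exists k => //; apply/compatibleP.
have h0 := seg_incl_pos sk (hv h ord0).
have := walkM (@tF_folded _) (walkV W) h0.
by rewrite -e mulKg.
Qed.

End TF.

(** * Axes of cyclically reduced words *)

Section Axis.
Variable n : nat.
Implicit Types (s t : seq (letter n)) (w p q : fgroup n).

(** Cyclically reduced words are the nonempty reduced words with reduced square. *)
Lemma cyc_reducedE s :
  cyc_reduced s = [&& s != [::], reduced s & diverge s (winv s)].
Proof.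
rewrite /cyc_reduced; case: (lastP s) => [|t c] //.
rewrite winv_rcons /reduced; case: t => [|a t] /=.
  by rewrite eq_sym andbT.
rewrite !rcons_path last_rcons; by bool_congr; rewrite andbT.
Qed.

Lemma cyc_reducedV w : cyc_reduced w -> cyc_reduced w^-1.
Proof.
rewrite !cyc_reducedE fwordV winvK reduced_winvE divergeC => /and3P[h -> ->].
by rewrite !andbT -size_eq0 size_winv size_eq0.
Qed.

Lemma cyc_neq1 w : cyc_reduced w -> w != 1.
Proof. by rewrite -size_gt0; apply: cyc_size. Qed.

Lemma cycXS w k : cyc_reduced w -> fword (w ^+ k.+1) = w ++ fword (w ^+ k).
Proof.
rewrite cyc_reducedE => /and3P[h1 h2 h3].
have H l : diverge (winv w) (fword (w ^+ l)) -> fword (w ^+ l.+1) = w ++ fword (w ^+ l).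
  by move=> h; rewrite expgS fwordM_cat // reduced_cat h2 h fwordP.
elim: k => [|k IH]; first by apply: H; case: (winv w).
by apply: H; rewrite IH; move: h3 h1; rewrite divergeC; case: (fword w) (winv _) => [|? ?] [|? ?].
Qed.

Lemma size_cycX w k : cyc_reduced w -> size (w ^+ k) = (k * size w)%N.
Proof. by move=> cw; elim: k => // k IH; rewrite cycXS // size_cat IH mulSn. Qed.

Lemma size_cycX_ge w k : cyc_reduced w -> k <= size (w ^+ k).
Proof. by move=> cw; rewrite size_cycX // leq_pmulr // cyc_size. Qed.

(** Positive and negative powers leave 1 in different directions. *)
Lemma cyc_divergeX w k l : cyc_reduced w -> diverge (w^-1 ^+ k) (w ^+ l).
Proof.
move=> cw; case: k => [|k] //; case: l => [|l]; first by case: (fword _).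
have h1 := cyc_size cw; have h2 := cyc_size (cyc_reducedV cw).
have : diverge (winv w) w by move: cw; rewrite cyc_reducedE divergeC => /and3P[].
rewrite !cycXS // ?cyc_reducedV //.
move: h2 h1; rewrite !fwordV; case: (winv w) => // c u _.
by case: (fword w).
Qed.

(** The vertices of the Cayley tree that can be reached from 1 by reading the
periodic word s: the axis of s when s is cyclically reduced. *)
Definition axis s p := exists x y : vert (circ s), nat_of_ord x = 0 /\ walk x p y.

Lemma axisP s (cs : cyc_reduced s) p : axis s p <-> exists y, walk (circ_origin cs) p y.
Proof.
split=> [[x [y [x0 h]]]|[y h]]; last by exists (circ_origin cs), y.
by exists y; have -> : circ_origin cs = x by apply: val_inj.
Qed.

Section Fixed.
Variable w : fgroup n.
Hypothesis cw : cyc_reduced w.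
Let fw := circ_folded cw.

Lemma circ_loopX k : walk (circ_origin cw) (w ^+ k) (circ_origin cw).
Proof. by apply: walkX => //; apply: circ_walk. Qed.

Lemma circ_loopVX k : walk (circ_origin cw) (w^-1 ^+ k) (circ_origin cw).
Proof. by apply: walkX => //; apply/walkV/circ_walk. Qed.

Lemma circ_power_loop h : is_power w h -> walk (circ_origin cw) h (circ_origin cw).
Proof. by move=> [k [->|->]]; [apply: circ_loopX|apply: circ_loopVX]. Qed.

Lemma axis_prefix p q : axis w q -> prefix p q -> axis w p.
Proof.
move=> [x [y [x0 h]]] /prefixP[r e]; move: h; rewrite e => /walk_cat[z [h _]].
by exists x, z.
Qed.

(** A walk from the origin of the circle starts in one of two directions, and
then follows a positive or a negative power of w. *)
Lemma axis_powers p k : size p <= k -> axis w p <-> prefix p (w ^+ k) || prefix p (w^-1 ^+ k).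
Proof.
move=> hk; split; last first.
  case/orP; apply: axis_prefix; apply/axisP; exists (circ_origin cw); [exact: circ_loopX|exact: circ_loopVX].
move/(axisP cw) => [y hy].
have h1 := circ_loopX k; have h2 := circ_loopVX k.
have d := @cyc_divergeX w k k cw.
have s1 := leq_trans hk (size_cycX_ge k cw).
have s2 := leq_trans hk (size_cycX_ge k (cyc_reducedV cw)).
have rp := fwordP p; have r1 := fwordP (w ^+ k); have r2 := fwordP (w^-1 ^+ k).
case: (fword p) rp hy s1 s2 => [|a t] rp hy; first by rewrite prefix0s.
case: (fword (w ^+ k)) r1 h1 d => [|b t1] r1 h1 d s1; first by [].
case: (fword (w^-1 ^+ k)) r2 h2 d => [|c t2] r2 h2 ne s2; first by [].
move: s1 s2; rewrite !prefix_cons !ltnS => s1 s2.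
case: (eqVneq a b) => [ab|nab] /=.
  by subst b; rewrite (circ_prefix cw rp r1 hy h1 s1).
case: (eqVneq a c) => [ac|nac] /=.
  by subst c; apply: (circ_prefix cw rp r2 hy h2 s2).
move: hy h1 h2 => /= [e [ex el _]] [e1 [ex1 el1 _]] [e2 [ex2 el2 _]].
have E : e1 = e2.
  refine (@circ_valence _ _ e1 e2 e _ _ _ _); rewrite /= ?ex ?ex1 ?ex2 // => E.
    by move: nab; rewrite -el -el1 E eqxx.
  by move: nac; rewrite -el -el2 E eqxx.
by move: ne; rewrite /= -el1 -el2 E eqxx.
Qed.

Lemma axisX k : axis w (w ^+ k).
Proof. by apply/(axisP cw); exists (circ_origin cw); apply: circ_loopX. Qed.

Lemma axis1 : axis w 1.
Proof. exact: axisX 0. Qed.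

Lemma axis_walk p q : axis w p -> axis w (p * q) -> exists x y, 
  [/\ walk (circ_origin cw) p x, walk (circ_origin cw) (p * q) y & walk x q y].
Proof.
move=> /(axisP cw)[x hx] /(axisP cw)[y hy]; exists x, y; split=> //.
by have := walkM fw (walkV hx) hy; rewrite mulKg.
Qed.

Lemma walk_axis (i j : vert (circ w)) q : walk i q j -> axis w (wprod (take i w) * q).
Proof.
move=> h; apply/(axisP cw); exists j; apply: walkM h => //.
exact: walk_wprod (circ_walk_take cw i).
Qed.

Lemma axis_take (i : vert (circ w)) : axis w (wprod (take i w)).
Proof. apply/(axisP cw); exists i; exact: walk_wprod (circ_walk_take cw i). Qed.

(** Axes are convex. *)
Lemma axis_segment p q (x : fgroup n) : axis w p -> axis w q -> between p q x -> axis w x.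
Proof.
move=> hp hq /between_cat e.
have [y [z []]] : exists y z, 
  [/\ walk (circ_origin cw) p y, walk (circ_origin cw) (p * (p^-1 * q)) z & walk y (p^-1 * q) z].
  by apply: axis_walk; rewrite ?mulVKg.
move=> h1 _; rewrite e => /walk_cat[v [h2 _]].
by apply/(axisP cw); exists v; have := walkM fw h1 h2; rewrite mulVKg.
Qed.

(** Axes have no end: a segment of an axis can be prolonged inside it. *)
Lemma axis_next p q : axis w p -> axis w q -> p != q -> exists a : letter n,
  size (p^-1 * q * gen a) = (size (p^-1 * q)).+1 /\ axis w (q * gen a).
Proof.
move=> hp hq ne.
have [y [z []]] : exists y z, 
  [/\ walk (circ_origin cw) p y, walk (circ_origin cw) (p * (p^-1 * q)) z & walk y (p^-1 * q) z].
  by apply: axis_walk; rewrite ?mulVKg.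
rewrite mulVKg => h1 h2 h3.
have : p^-1 * q != 1.
  by apply: contra ne => /eqP/mulg1_eq; rewrite invgK => ->.
rewrite -size_gt0; case/lastP E : (fword (p^-1 * q)) => [|s c] // _.
have [e [ex el]] := circ_next cw z (linv c).
exists (lab e); split.
  have r : reduced (fword (p^-1 * q) ++ fword (gen (lab e))).
    rewrite reduced_cat !fwordP E winv_rcons /=.
    by rewrite ?andbT; apply/eqP => h; apply: el; rewrite h.
  by rewrite (fwordM_cat r) size_cat addn1 E.
apply/(axisP cw); exists (term e); apply: walkM h2 _ => //.
by exists e.
Qed.

End Fixed.

Lemma diverge_take s t k : 0 < k -> diverge (take k s) (take k t) = diverge s t.
Proof. by case: k s t => // k [|a s] [|b t]. Qed.

(** For k large the vertices w^-k x and w^k x leave the axis far away from 1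
and p, so that near 1 the geodesic joining them runs along the axis. *)
Lemma axis_between w (x : fgroup n) p k : cyc_reduced w -> size p + size x < k ->
  axis w p <-> between (w^-1 ^+ k * x) (w ^+ k * x) p.
Proof.
move=> cw hk; set m := k - size x.
have T (v : fgroup n) : cyc_reduced v -> take m (v ^+ k * x) = take m (v ^+ k) .
  move=> cv; apply: take_mul; have := size_cycX_ge k cv; rewrite /m; lia.
have P (v : fgroup n) : cyc_reduced v -> prefix p (v ^+ k * x) = prefix p (v ^+ k).
  have hm : size p <= m by rewrite /m; lia.
  by move=> cv; rewrite !prefixE -(take_takel (v ^+ k * x) hm) -(take_takel (v ^+ k) hm) T.
have d : diverge (w^-1 ^+ k * x) (w ^+ k * x).
  have m0 : 0 < m by rewrite /m; lia.
  by rewrite -(diverge_take _ _ m0) !T ?cyc_reducedV // diverge_take ?cyc_divergeX.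
rewrite between_prefix // !P ?cyc_reducedV // orbC; apply: axis_powers => //; lia.
Qed.

Lemma strip_cyc s : cyc_reduced s -> strip s = s.
Proof.
case: s => // a t; rewrite cyc_reducedE /= => /andP[_].
case: ifP => // /eqP e; case: (lastP t) e => [|t' c] /=.
  by move=> e; have := linv_neq a; rewrite -e eqxx.
by rewrite last_rcons => ->; rewrite -rcons_cons winv_rcons linvK eqxx.
Qed.

Lemma stripP s : s != [::] -> reduced s -> ~~ cyc_reduced s ->
  [/\ strip s != [::], reduced (strip s), size (strip s) < size s &
      exists g, s = g ++ strip s ++ winv g].
Proof.
move=> s0 rs; rewrite cyc_reducedE s0 rs /=.
case: s s0 rs => // a t _; case: (lastP t) => [|t' c] rs.
  by rewrite /= /winv /= eq_sym linv_neq.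
rewrite -rcons_cons winv_rcons /= last_rcons negbK => /eqP ac.
have {}ac : c = linv a by rewrite ac linvK.
rewrite ac eqxx size_rcons /= -cats1 take_size_cat //.
split=> //; last by exists [:: a].
- by apply: contraTneq rs => ->; rewrite /reduced /= ac eqxx.
- by move: rs; rewrite -cats1 => /reduced_behead/reduced_catl.
Qed.

(** Each effective step of the cyclic reduction removes a letter at both ends, and
size s steps are enough to reach a cyclically reduced word. *)
Lemma cycredP s : s != [::] -> reduced s ->
  cyc_reduced (cycred s) /\ exists g, s = g ++ cycred s ++ winv g.
Proof.
rewrite /cycred; move: {-1}(size s) (leqnn (size s)) => k.
elim: k s => [|k IH] s hk s0 rs; first by case: s s0 hk {rs}.
rewrite iterSr; case: (boolP (cyc_reduced s)) => [cs|ncs].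
  rewrite strip_cyc //; have -> : iter k (@strip n) s = s.
    by elim: k {IH hk} => // k IH; rewrite iterS IH strip_cyc.
  by split=> //; exists [::]; rewrite cats0.
have [h1 h2 h3 [g eg]] := stripP s0 rs ncs.
have [c [g' eg']] := IH (strip s) (leq_trans h3 hk) h1 h2.
by split=> //; exists (g ++ g'); rewrite {1}eg {1}eg' winv_cat !catA.
Qed.

Lemma cycred_conj (x : fgroup n) : x != 1 -> exists c : fgroup n,
  [/\ fword c = cycred x, cyc_reduced c &
      exists2 g : fgroup n, x = g * c * g^-1 & fword x = g ++ c ++ winv g].
Proof.
move=> x1; have x0 : fword x != [::] by rewrite -size_eq0 -lt0n size_gt0.
have [cc [g eg]] := cycredP x0 (fwordP x).
have rg : reduced g by apply: (@reduced_catl _ _ (cycred x ++ winv g)); rewrite -eg fwordP.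
exists (wprod (cycred x)); rewrite fword_cyc //; split=> //.
exists (wprod g); last by rewrite fword_wprod.
by rewrite -wprod_winv -!wprod_cat -catA -eg wprodK.
Qed.

End Axis.

(** * Segments, spheres and axes *)

Section Tree.
Variable n : nat.
Implicit Types (a b x y A B p q : fgroup n).

Lemma between_prefix1 p q x : between p q x = prefix (fword (p^-1 * x)) (fword (p^-1 * q)).
Proof. by rewrite -(between_mul p^-1) mulVg between1_prefix. Qed.

Lemma between_order A B a b : between A B a -> between A B b -> between A b a || between A a b.
Proof.
rewrite !between_prefix1 !prefixE => /eqP ea /eqP eb.
case: (leqP (size (A^-1 * a)) (size (A^-1 * b))) => h.
  by rewrite -eb take_takel // ea eqxx.
by rewrite -ea take_takel ?(ltnW h) // eb eqxx orbT.
Qed.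

(** For points met in the order A, a, b, B. *)
Lemma between_tail A B a b : between A B b -> between A b a -> between a B b.
Proof.
rewrite /between => /eqP h1 /eqP h2; apply/eqP.
have := triangle a b B; have := triangle A a B; lia.
Qed.

Lemma between_extend A B b b' : between A B b -> between b B b' -> between A B b'.
Proof.
rewrite /between => /eqP h1 /eqP h2; apply/eqP.
have := triangle A b b'; have := triangle A b' B; lia.
Qed.

(** Two geodesics overlapping in the nondegenerate segment [a, b] form a
geodesic. *)
Lemma between_glue A a b b' : a != b -> between A b a -> between a b' b -> between A b' b.
Proof.
move=> ne /between_cat h1 /between_cat h2.
have r : reduced (fword (A^-1 * b) ++ fword (b^-1 * b')).
  rewrite h1; apply: reduced_glue; last by rewrite -h2 fwordP.
    rewrite -size_eq0 -lt0n size_gt0; apply: contra ne => /eqP/mulg1_eq.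
    by rewrite invgK => ->.
  by rewrite -h1 fwordP.
have := fwordM_cat r; rewrite mulgA mulgK => e.
by rewrite /between e size_cat.
Qed.

Lemma diverge_take1 (s t s' : seq (letter n)) : take 1 s = take 1 s' -> diverge s t = diverge s' t.
Proof. by move=> e; rewrite -(diverge_take _ _ (isT : 0 < 1)) e diverge_take. Qed.

(** Leaving a for a vertex b which is not farther from 1, one moves towards 1. *)
Lemma head_in a b : size b <= size a -> a != b ->
  take 1 (a^-1 * b) = take 1 a^-1 /\ 0 < size (a^-1 * b).
Proof.
move=> hs ne; case: (mulVwP a b) => m [s [t [ea eb eab _]]].
have s0 : 0 < size s.
  rewrite lt0n; apply/eqP => /size0nil s0; move: hs; rewrite ea eb s0 cats0 size_cat => hs.
  have t0 : t = [::] by apply: size0nil; lia.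
  by move: ne; rewrite -(inj_eq (@fword_inj n)) ea eb s0 t0 eqxx.
rewrite eab fwordV ea winv_cat size_cat size_winv; split; last by lia.
by rewrite !takel_cat ?size_winv.
Qed.

(** The geodesic from A to b arrives at a from the side opposite to 1, because it
leaves a towards 1 by [head_in]; hence A lies behind a. *)
Lemma sphere_out A a b : between A b a -> a != b -> size b <= size a -> prefix a A.
Proof.
move=> h ne hs; have [e _] := head_in hs ne.
have : between (a^-1 * A) (a^-1 * b) (a^-1 * a) by rewrite between_mul.
rewrite mulVg between1 divergeC (diverge_take1 _ e) -between1 -(between_mul a) mulg1 mulgV mulVKg.
by rewrite between1_prefix.
Qed.

(** If A and B have different projections to the ball of radius R, then the geodesic
joining them runs through the projection of A. *)
Lemma between_take_diverge R A B : take R A != take R B -> between A B (wprod (take R A)).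
Proof.
case: (lcpP A B) => m [s [t [ea eb d]]] ne.
have hm : size m < R.
  rewrite ltnNge; apply: contra ne => h; rewrite ea eb !takel_cat //.
have rs : reduced s by apply: (@reduced_catr _ m); rewrite -ea fwordP.
have rt : reduced t by apply: (@reduced_catr _ m); rewrite -eb fwordP.
have -> : wprod (take R A) = wprod m * wprod (take (R - size m) s).
  by rewrite ea take_cat ltnNge (ltnW hm) /= wprod_cat.
have -> : A = wprod m * wprod s by rewrite -wprod_cat -ea wprodK.
have -> : B = wprod m * wprod t by rewrite -wprod_cat -eb wprodK.
rewrite between_mul between_prefix !fword_wprod ?prefix_take //.
by rewrite /reduced take_sorted.
Qed.

Definition on_axis w z (p : fgroup n * fgroup n) := axis w (z^-1 * p.1) /\ axis w (z^-1 * p.2).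

Lemma on_axis_segment (w : fgroup n) z A B x : cyc_reduced w -> on_axis w z (A, B) -> between A B x -> axis w (z^-1 * x).
Proof. by move=> cw [hA hB] h; apply: axis_segment hA hB _ => //; rewrite between_mul. Qed.

(** A geodesic line meets a sphere in at most two points: from x, the paths to y
and to y' both start towards 1, so one extends the other. *)
Lemma axis_sphere (w : fgroup n) z x y y' : cyc_reduced w ->
  axis w (z^-1 * x) -> axis w (z^-1 * y) -> axis w (z^-1 * y') ->
  size y = size x -> size y' = size x -> x != y -> x != y' -> y = y'.
Proof.
move=> cw hx; wlog le : y y' / size (x^-1 * y) <= size (x^-1 * y').
  move=> H h1 h2 h3 h4 h5 h6.
  case: (leqP (size (x^-1 * y)) (size (x^-1 * y'))) => h; first exact: H.
  by symmetry; apply: H => //; apply: ltnW.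
move=> hy hy' sy sy' ne ne'.
have W v : axis w (z^-1 * v) -> exists i j, walk (circ_origin cw) (z^-1 * x) i /\ walk i (x^-1 * v) j.
  move=> hv; have := @axis_walk _ _ cw (z^-1 * x) (x^-1 * v) hx.
  by rewrite mulgA mulgK => /(_ hv) [i [j [? _ ?]]]; exists i, j.
have [i [j [h1 h2]]] := W _ hy; have [i' [j' [h1' h2']]] := W _ hy'.
have ei := walk_fun (circ_folded cw) h1 h1'; subst i'.
have [e1 p1] := head_in (eq_leq sy) ne; have [e2 p2] := head_in (eq_leq sy') ne'.
have pf : prefix (fword (x^-1 * y)) (fword (x^-1 * y')).
  move: (fwordP (x^-1 * y)) (fwordP (x^-1 * y')) h2 h2' le p1 p2 (etrans e1 (esym e2)).
  case: (fword (x^-1 * y)) => [|c s] //; case: (fword (x^-1 * y')) => [|d t] // rs rt hs ht le _ _ /=.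
  rewrite !take0 => -[ecd]; subst d; rewrite eqxx /=.
  exact: (circ_prefix cw rs rt hs ht).
rewrite -between_prefix1 between_sym in pf.
have nyx : y != x by rewrite eq_sym.
have := sphere_out pf nyx; rewrite sy leqnn => /(_ isT).
rewrite prefixE => /eqP e; apply: fword_inj; rewrite -e take_oversize //.
by rewrite sy sy'.
Qed.

End Tree.

(** * Metric distortion of automorphisms *)

Section Bound.
Variable n : nat.

Lemma lipschitz (f : fgroup n -> fgroup n) : {morph f : x y / x * y} ->
  exists L, forall x, size (f x) <= L * size x.
Proof.
move=> fM; have f1 : f 1 = 1 by apply: (mulgI (f 1)); rewrite mulg1 -fM mulg1.
exists (\max_(c : letter n) size (f (gen c))) => x.
rewrite -[x in f x]wprodK; elim: (fword x) => [|c s IH].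
  by rewrite wprod_nil f1.
rewrite wprod_cons fM /= mulnS; apply: leq_trans (sizeM _ _) (leq_add _ IH).
exact: (leq_bigmax (F := fun c => size (fword (f (gen c))))).
Qed.

(** The inverse automorphism is also Lipschitz, so phi moves far vertices far
away. *)
Lemma proper (phi : aut n) K : exists R, forall a : fgroup n, R <= size a -> K <= size (phi a).
Proof.
have [psi k1 k2] := aut_bij phi.
have [L hL] := lipschitz (can2_gmulfM k1 k2).
exists (L * K)%N.+1 => a; rewrite ltnNge => h; rewrite leqNgt; apply: contra h => h.
by have := hL (phi a); rewrite k1 => /leq_trans-> //; rewrite leq_mul2l (ltnW h) orbT.
Qed.

End Bound.

(** * Forcing segments and full lists *)

Section Force.
Variables (n : nat) (phi : aut n) (u : fgroup n).
Hypothesis u1 : u != 1.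
Implicit Types (a b x y z A B : fgroup n) (p q : fgroup n * fgroup n).

(** The vertices behind u seen from 1. *)
Definition beyond x := prefix u x.
(** The vertices that are not separated from 1 by the first edge of [1, u]. *)
Definition before x := take 1 x != take 1 u.

(** Equivalent by [acrossP] to the segment [p, q] containing [1, u].  In this
form it visibly depends on the first size u letters of p and q only. *)
Definition across (p q : fgroup n) := (before p && beyond q) || (beyond p && before q).

Lemma beyond_take x : beyond x = (take (size u) x == u).
Proof. exact: prefixE. Qed.

Let su : 0 < size u.
Proof. by rewrite size_gt0. Qed.

Lemma before_take x : before x = (take 1 (take (size u) x) != take 1 u).
Proof. by rewrite take_takel. Qed.

Lemma beyond_before x : beyond x -> before x = false.
Proof. by rewrite beyond_take before_take => /eqP ->; rewrite eqxx. Qed.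

Lemma across_sym (p q : fgroup n) : across p q = across q p.
Proof. by rewrite /across orbC; congr (_ || _); apply: andbC. Qed.

Lemma across_take (p q p' q' : fgroup n) : take (size u) p = take (size u) p' ->
  take (size u) q = take (size u) q' -> across p q = across p' q'.
Proof. by rewrite /across !beyond_take !before_take => -> ->. Qed.

Lemma beyond_diverge x y : beyond x -> diverge x y = before y.
Proof.
move/prefixP=> [r ->]; rewrite /before.
move: su; case: (fword u) => // c s _; case: (fword y) => //= d t.
by rewrite !take0 eqseq_cons andbT eq_sym.
Qed.

Lemma acrossP (p q : fgroup n) : across p q <-> between p q 1 /\ between p q u.
Proof.
rewrite between1 /across; split.
  case/orP => /andP[h1 h2].
    have d : diverge p q by rewrite divergeC beyond_diverge.
    by rewrite between_prefix // -/(beyond _) -/(beyond _) h2 orbT.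
  have d : diverge p q by rewrite beyond_diverge.
  by rewrite between_prefix // -/(beyond _) -/(beyond _) h1.
move=> [d]; rewrite between_prefix // => /orP[] h.
  by rewrite -/(beyond p) in h; rewrite h -(beyond_diverge q h) d orbT.
by rewrite -/(beyond q) in h; rewrite h -(beyond_diverge p h) divergeC d.
Qed.

(** If [p, q], [p, q'] and [p', q'] all cross [1, u], then q and q' are on the
same side, and so are p and p'. *)
Lemma across_square (p q p' q' : fgroup n) :
  across p q -> across p q' -> across p' q' -> across p' q.
Proof.
rewrite /across; case/orP => /andP[h1 h2].
  rewrite h1 h2; case/orP => /andP[h3 h4].
    by rewrite h4 (beyond_before h4) /= andbF orbF => /andP[-> _].
  by rewrite (beyond_before h3) in h1.
rewrite h1 h2 (beyond_before h1) /= => h3.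
by case/orP => /andP[h4 h5]; rewrite ?h4 ?orbT //; rewrite (beyond_before h5) in h3.
Qed.

(** Up to translation, ideal preimages of u are the segments [a, b] such that the
image of every segment containing [a, b] covers [1, u]. *)
Definition force a b := a <> b /\
  forall A B, between A B a -> between A B b -> across (phi A) (phi B).

Lemma force_sym a b : force a b -> force b a.
Proof.
case=> ne h; split; first by move=> e; apply: ne.
by move=> A B hb ha; apply: h.
Qed.

Lemma force_across a b : force a b -> across (phi a) (phi b).
Proof. by case=> _; apply; [apply: betweenl|apply: betweenr]. Qed.

(** Once phi x is farther from 1 than size u by more than the length of the
images of the letters, a further step in x does not alter the first size u
letters of phi x. *)
Lemma stable_radius : exists R, forall a x : fgroup n, size a = R -> prefix a x ->
  take (size u) (phi x) = take (size u) (phi a).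
Proof.
have [L hL] : exists L, forall x, size (phi x) <= L * size x.
  by apply: lipschitz => x y; rewrite gmulfM.
have [R hR] := proper phi (size u + L); exists R => a x sa /prefixP[r er].
have : reduced (a ++ r) by rewrite -er fwordP.
have -> : x = wprod (a ++ r) by rewrite -er wprodK.
elim/last_ind: r {x er} => [|r c IH] rd; first by rewrite cats0 wprodK.
move: rd; rewrite -rcons_cat => rd.
have rd' : reduced (a ++ r) by move: rd; rewrite -cats1 => /reduced_catl.
rewrite -(IH rd') wprod_rcons gmulfM; apply: take_mul.
apply: leq_trans (hR _ _); last by rewrite fword_wprod // size_cat sa leq_addr.
by rewrite leq_add2l (leq_trans (hL _)) //= muln1.
Qed.

(** The image under phi of the axis of w translated by z has an axis containing
[1, u]: it is the translate by p^-1 of the axis of s, and a power h of w, with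
s and h different from 1, translates along it after conjugation by z. *)
Definition image_axis (w : fgroup n) z := exists s p h : fgroup n,
  [/\ cyc_reduced s, axis s p, axis s (p * u), is_power w h &
      p^-1 * s * p = phi (z * h * z^-1)].

(** Both ends of the translated axis go to infinity, and the images of far
vertices on both sides are separated by [1, u]. *)
Lemma image_axis_ends (w : fgroup n) z K : cyc_reduced w -> image_axis w z ->
  exists A B, [/\ on_axis w z (A, B), K <= size A, K <= size B & across (phi A) (phi B)].
Proof.
move=> cw [s [p [h [cs h1 h2 ph e]]]].
set x := p * phi z.
(* k is beyond the bounds of [axis_between] at p and at p u, and large enough *)
(* for z h^k and z h^-k to lie outside the ball of radius K                   *)
pose k := (maxn (size p) (size (p * u)) + size x + K + size z).+1.
have hn1 : h != 1.
  apply: contra (cyc_neq1 cs) => /eqP h1'; move: e.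
  rewrite h1' mulg1 mulgV aut1 => e; apply/eqP.
  have -> : s = p * (p^-1 * s * p) * p^-1 by rewrite !mulgA mulgV mul1g mulgK.
  by rewrite e mulg1 mulgV.
have eV : p^-1 * s^-1 * p = phi (z * h^-1 * z^-1).
  have -> : z * h^-1 * z^-1 = (z * h * z^-1)^-1 by rewrite !invgM invgK mulgA.
  by rewrite autV -e !invgM invgK mulgA.
have X (v g : fgroup n) l : p^-1 * v * p = phi (z * g * z^-1) ->
    phi (z * g ^+ l) = p^-1 * (v ^+ l * x).
  move=> E; have := conjX p^-1 v l; rewrite invgK E -autX conjX => E'.
  by rewrite /x !mulgA -E' -gmulfM mulgVK.
have S g : is_power w g -> g != 1 -> K <= size (z * g ^+ k).
  have sk (v : fgroup n) l : cyc_reduced v -> v ^+ l != 1 -> K + size z <= size ((v ^+ l) ^+ k).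
    move=> cv; rewrite -expgnA size_cycX // -size_gt0 size_cycX // => h0.
    rewrite mulnAC; apply: leq_trans (leq_pmull _ h0); rewrite /k; lia.
  move=> pg g1; have : K + size z <= size (g ^+ k).
    case: pg g1 => l [->|->]; first exact: sk.
    by apply: sk; apply: cyc_reducedV.
  have := sizeM z^-1 (z * g ^+ k); rewrite mulKg sizeV; lia.
exists (z * h^-1 ^+ k), (z * h ^+ k); split.
- rewrite /on_axis /= !mulKg; split; apply/(axisP cw); exists (circ_origin cw).
    apply: walkX; first exact: circ_folded.
    exact/circ_power_loop/is_powerV.
  apply: walkX; first exact: circ_folded.
  exact/circ_power_loop.
- by apply: S; [apply: is_powerV | rewrite invg_eq1].
- exact: S.
apply/acrossP; rewrite (X _ _ k e) (X _ _ k eV) -(between_mul p) -(between_mul p _ _ u) !mulVKg mulg1.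
by split; apply/axis_between => //; rewrite /k; lia.
Qed.

(** The list counterpart of a full set.  A segment is unordered; it is
represented by the ordered pair whose first vertex has an image behind u and
whose second vertex has an image on the side of 1, which makes the
representative unique. *)
Definition full_list (S : seq (fgroup n * fgroup n)) :=
  [/\ uniq S,
    forall p : fgroup n * fgroup n, p \in S -> [/\ force p.1 p.2, beyond (phi p.1) & before (phi p.2)] &
    forall w z : fgroup n, cyc_reduced w -> image_axis w z ->
      exists p : fgroup n * fgroup n, [/\ p \in S, on_axis w z p &
        forall q : fgroup n * fgroup n, q \in S -> on_axis w z q -> q = p]].

(** The list consists of the segments with ends on the sphere of a radius R as in
[stable_radius] that cross [1, u].  An axis with image through [1, u] must
enter and leave the ball of radius R at such a pair of points, and it meets the
sphere nowhere else. *)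
Lemma full_list_exists : exists S, full_list S.
Proof.
have [R hR] := stable_radius.
pose Ws := [seq wprod (tval t) | t <- enum {: R.-tuple (letter n)}].
have WsP a : size a = R -> a \in Ws.
  move=> sa; apply/mapP; have sa' : size (fword a) == R by apply/eqP.
  by exists (Tuple sa'); rewrite ?mem_enum //= wprodK.
pose S := undup [seq p : fgroup n * fgroup n <- [seq (a, b) | a <- Ws, b <- Ws] |
  [&& size p.1 == R, size p.2 == R, beyond (phi p.1) & before (phi p.2)]].
have SP a b : reflect [/\ size a = R, size b = R, beyond (phi a) & before (phi b)] ((a, b) \in S).
  rewrite mem_undup mem_filter /=; apply: (iffP andP) => [[/and4P[/eqP ? /eqP ? ? ?]] //|].
  move=> [sa sb ha hb]; rewrite sa sb !eqxx ha hb; split=> //.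
  by apply: allpairs_f; apply: WsP.
have ne a b : beyond (phi a) -> before (phi b) -> a != b.
  by move=> h1; apply: contraTneq => <-; rewrite (beyond_before h1).
exists S; split; first exact: undup_uniq.
  move=> [a b] /SP[sa sb ha hb] /=; have nab := ne _ _ ha hb; split=> //; split; first exact/eqP.
  move=> A B oa ob.
  have key A' B' a' b' : size a' = R -> size b' = R -> a' != b' -> between A' B' a' -> between A' B' b' -> between A' b' a' ->
      across (phi A') (phi B') = across (phi a') (phi b').
    move=> sa' sb' n' o1 o2 o3; apply: across_take; apply: hR => //.
      by apply: (sphere_out o3 n'); rewrite sa' sb'.
    apply: (@sphere_out _ B' b' a'); rewrite ?sa' ?sb' // 1?eq_sym // between_sym.
    exact: between_tail o2 o3.
  have ac : across (phi a) (phi b) by rewrite /across ha hb orbT.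
  case/orP: (between_order oa ob) => o.
    by rewrite (key A B a b).
  by rewrite (key A B b a) // 1?eq_sym // across_sym.
move=> w z cw /(image_axis_ends R cw) [A [B [hAB sA sB ac]]].
have key A' B' : on_axis w z (A', B') -> R <= size A' -> R <= size B' ->
    beyond (phi A') -> before (phi B') -> exists2 p : fgroup n * fgroup n, p \in S & on_axis w z p.
  move=> hl hA hB bA bB.
  pose a := wprod (take R A'); pose b := wprod (take R B').
  have rA : reduced (take R A') by rewrite /reduced take_sorted // -/(reduced _) fwordP.
  have rB : reduced (take R B') by rewrite /reduced take_sorted // -/(reduced _) fwordP.
  have sa : size a = R by rewrite fword_wprod // size_takel.
  have sb : size b = R by rewrite fword_wprod // size_takel.
  have pa : prefix a A' by rewrite fword_wprod // prefix_take.
  have pb : prefix b B' by rewrite fword_wprod // prefix_take.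
  have ba : beyond (phi a) by move: bA; rewrite !beyond_take (hR _ _ sa pa).
  have bb : before (phi b) by move: bB; rewrite !before_take (hR _ _ sb pb).
  have nab := ne _ _ ba bb.
  have nt : take R A' != take R B' by apply: contra nab; rewrite /a /b => /eqP ->.
  exists (a, b); first by apply/SP.
  split; apply: on_axis_segment hl _ => //; first exact: between_take_diverge.
  by rewrite between_sym; apply: between_take_diverge; rewrite eq_sym.
have [p pS hp] : exists2 p : fgroup n * fgroup n, p \in S & on_axis w z p.
  case/orP: ac => /andP[h1 h2]; last exact: key hAB _ _ _ _.
  by apply: (key B A) => //; case: hAB.
exists p; split=> // -[a' b'] qS [q1 q2]; case: p pS hp => a b /SP[sa sb ha hb] [p1 p2].
case/SP: qS => sa' sb' ha' hb'; rewrite /= in p1 p2 q1 q2.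
have nab := ne _ _ ha hb; have nab' := ne _ _ ha hb'; have na'b := ne _ _ ha' hb.
have eb : b' = b.
  by apply: (axis_sphere cw p1 q2 p2) => //; congruence.
have ea : a' = a.
  by apply: (axis_sphere cw p2 q1 p1); rewrite 1?eq_sym //; congruence.
by rewrite ea eb.
Qed.

(** The representative of the unordered pair p used in [full_list]. *)
Definition orient (p : fgroup n * fgroup n) := if beyond (phi p.1) then p else (p.2, p.1).

Lemma on_axis_orient w z (p : fgroup n * fgroup n) : on_axis w z (orient p) <-> on_axis w z p.
Proof. by rewrite /orient; case: ifP => // _; split=> -[]. Qed.

Lemma force_orient (p : fgroup n * fgroup n) : force (orient p).1 (orient p).2 -> force p.1 p.2.
Proof. by rewrite /orient; case: ifP => // _; apply: force_sym. Qed.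

(** The list counterpart of a full paradigm extending [a, b] at b. *)
Definition paradigm (S : seq (fgroup n * fgroup n)) a b :=
  [/\ a <> b, across (phi a) (phi b) & forall c : letter n,
    size (a^-1 * b * gen c) = (size (a^-1 * b)).+1 -> orient (a, b * gen c) \in S].

Lemma between_step a b (c : letter n) :
  size (a^-1 * b * gen c) = (size (a^-1 * b)).+1 -> between a (b * gen c) b.
Proof. by rewrite /between mulKg -mulgA => -> /=; rewrite addn1. Qed.

(** A longer segment either continues [a, b] at b, and then contains some
[a, bc], or ends at b.  In the second case it is compared with the segment
ending at bc by [across_square]. *)
Lemma paradigm_force S a b : full_list S -> paradigm S a b ->
  (exists c : letter n, size (a^-1 * b * gen c) = (size (a^-1 * b)).+1) ->
  force a b.
Proof.
move=> [_ hS _] [ne ac hp] [c0 hc0]; split=> //.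
have F c : size (a^-1 * b * gen c) = (size (a^-1 * b)).+1 -> force a (b * gen c).
  by move=> /hp/hS[/force_orient].
have neb : a != b by apply/eqP.
have key A B : between A B b -> between A b a -> across (phi A) (phi B).
  move=> ob oa.
  have oaB : between A B a.
    rewrite between_sym; apply: between_extend (_ : between B A b) _; first by rewrite between_sym.
    by rewrite between_sym.
  have e : fword (a^-1 * B) = (a^-1 * b) ++ (b^-1 * B) by apply/between_cat/between_tail/oa.
  case E : (fword (b^-1 * B)) e => [|c r] e.
    have eB : B = b by apply/esym/eqP; rewrite -[B](mulVKg b) (_ : b^-1 * B = 1) ?mulg1 //; apply: fword_inj.
    rewrite eB; have Fc := F _ hc0.
    apply: across_square ac (force_across Fc) _.
    case: Fc => _; apply; last exact: betweenr.
    have oAb : between A (b * gen c0) b by apply: between_glue neb oa _; apply: between_step.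
    rewrite between_sym; apply: between_extend (_ : between (b * gen c0) A b) _; first by rewrite between_sym.
    by rewrite between_sym.
  have hc : size (a^-1 * b * gen c) = (size (a^-1 * b)).+1.
    have rd : reduced (fword (a^-1 * b) ++ fword (gen c)).
      by apply: (@reduced_catl _ _ r); rewrite -catA /= -e fwordP.
    by rewrite (fwordM_cat rd) size_cat addn1.
  case: (F _ hc) => _; apply=> //; apply: between_extend ob _.
  by have := @cat_between _ b B [:: c] r E; rewrite wprod1.
move=> A B oa ob; case/orP: (between_order oa ob) => o; first exact: key.
rewrite across_sym; apply: key; first by rewrite between_sym.
by rewrite between_sym; apply: between_tail o.
Qed.

(** An axis containing [a, b] continues at b in exactly one way, so it contains
exactly one of the segments [a, bc]; replacing them all by [a, b] preserves
fullness. *)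
Lemma reduce_paradigm (hn : 1 < n) S a b : full_list S -> paradigm S a b ->
  exists2 S', full_list S' & size S' < size S.
Proof.
move=> fS pS; have [uS hS lS] := fS; have [ne ac hp] := pS.
have neb : a != b by apply/eqP.
pose good (c : letter n) := size (a^-1 * b * gen c) == (size (a^-1 * b)).+1.
(* some generator is not that of the last letter of a^-1 b, as n > 1; this   *)
(* generator and its inverse both continue [a, b]                            *)
have [c1 [c2 [g1 g2 n12]]] : exists c1 c2, [/\ good c1, good c2 & c1 != c2].
  have : 0 < size (a^-1 * b).
    rewrite size_gt0; apply: contra neb => /eqP/mulg1_eq.
    by rewrite invgK => ->.
  case/lastP E : (fword (a^-1 * b)) => [|s d] // _.
  have H j e : j != d.1 -> good (j, e).
    move=> hj; rewrite /good.
    have rd : reduced (fword (a^-1 * b) ++ fword (gen (j, e))).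
      rewrite reduced_cat !fwordP E winv_rcons /=.
      by apply/eqP => h; move: hj; rewrite -[j]/((j, e).1) -h eqxx.
    by rewrite (fwordM_cat rd) size_cat addn1.
  have [j hj] : exists j : 'I_n, j != d.1.
    case: (eqVneq (Ordinal hn) d.1) => [e|h]; last by exists (Ordinal hn).
    by exists (Ordinal (ltnW hn)); rewrite -e.
  by exists (j, true), (j, false); split; [apply: H|apply: H|rewrite xpair_eqE andbF].
have fo : force a b.
  by apply: paradigm_force fS pS _; exists c1; apply/eqP.
pose T := [seq orient (a, b * gen c) | c <- enum {: letter n} & good c].
have TP c : good c -> orient (a, b * gen c) \in T.
  by move=> gc; apply/mapP; exists c; rewrite // mem_filter gc mem_enum.
have TS (p : fgroup n * fgroup n) : p \in T -> exists2 c, p = orient (a, b * gen c) & good c.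
  by case/mapP => c; rewrite mem_filter => /andP[gc _] ->; exists c.
have TS' (p : fgroup n * fgroup n) : p \in T -> p \in S by move=> /TS [c -> /eqP/hp].
pose F := [seq p : fgroup n * fgroup n <- S | (p \notin T) && (p != orient (a, b))].
exists (orient (a, b) :: F); last first.
  have : 2 <= count (fun p => p \in T) S.
    rewrite -size_filter; apply: (@uniq_leq_size _ [:: orient (a, b * gen c1); orient (a, b * gen c2)]).
      rewrite /= andbT inE; apply: contra n12; rewrite /orient /=.
      by case: ifP => _; rewrite xpair_eqE eqxx ?andbT /= (inj_eq (mulgI b)) => /eqP[->].
    move=> p; rewrite !inE mem_filter => /orP[] /eqP ->; rewrite TP // TS' //; exact: TP.
  have := count_predC (fun p => p \in T) S.
  have : size F <= count (predC (fun p => p \in T)) S.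
    by rewrite size_filter; apply: sub_count => p /andP[].
  rewrite /=; lia.
have off (w : fgroup n) z c : cyc_reduced w -> on_axis w z (orient (a, b * gen c)) -> good c -> on_axis w z (orient (a, b)).
  move=> cw /on_axis_orient h /eqP/between_step ob; apply/on_axis_orient; split; first by case: h.
  exact: on_axis_segment h ob.
split.
- by rewrite /= filter_uniq // mem_filter eqxx /= andbF.
- move=> p; rewrite inE => /orP[/eqP ->|]; last by rewrite mem_filter => /andP[_ /hS].
  rewrite /orient /=; case/orP: ac => /andP[h1 h2].
    case: ifP => [h3|_]; first by rewrite (beyond_before h3) in h1.
    by split=> //; apply: force_sym.
  by rewrite h1.
- move=> w z cw hz; have [p [hpS hpl hpu]] := lS w z cw hz.
  case: (boolP (p \in T)) => [pT|npT].
    have [c ep gc] := TS _ pT.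
    exists (orient (a, b)); split; first by rewrite inE eqxx.
      by apply: (off w z c) => //; rewrite -ep.
    move=> q; rewrite inE => /orP[/eqP //|]; rewrite mem_filter => /andP[/andP[h1 h2] qS] ql.
    by move: h1; rewrite (hpu q qS ql) pT.
  have nab : ~ on_axis w z (orient (a, b)).
    move/on_axis_orient => [la lb].
    have ne' : z^-1 * a != z^-1 * b by apply: contra neb => /eqP/mulgI/eqP.
    have [c []] := axis_next cw la lb ne'.
    rewrite invgM invgK -!mulgA !mulVKg !mulgA => hc lc.
    have gc : good c by apply/eqP.
    have := hpu (orient (a, b * gen c)) (hp c hc).
    have il : on_axis w z (orient (a, b * gen c)).
      by apply/on_axis_orient; split=> //=; rewrite mulgA.
    by move/(_ il) => e; move: npT; rewrite -e TP.
  exists p; split=> //.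
    rewrite inE mem_filter npT hpS andbT; apply/orP; right.
    by apply/eqP => e; apply: nab; rewrite -e.
  move=> q; rewrite inE => /orP[/eqP -> /nab //|]; rewrite mem_filter => /andP[_ qS].
  exact: hpu.
Qed.

(** Reducing full paradigms decreases the size of the list, so this comes to an
end. *)
Lemma minimal_list_exists (hn : 1 < n) :
  exists2 S, full_list S & forall a b, ~ paradigm S a b.
Proof.
have [S0 f0] := full_list_exists.
elim: {S0}(size S0) {-2}S0 (leqnn (size S0)) f0 => [|k IH] S hk fS.
  exists S => // a b h; have [S' _] := reduce_paradigm hn fS h.
  by move: hk; rewrite leqn0 => /eqP ->.
case: (pselect (exists a b, paradigm S a b)) => [[a [b h]]|h].
  have [S' fS' hs] := reduce_paradigm hn fS h.
  by apply: (IH S') => //; rewrite -ltnS (leq_trans hs).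
by exists S => // a b hab; apply: h; exists a, b.
Qed.

End Force.

(** * Ideal preimages as forcing segments *)

(** The literal decomposition, not only conjugacy, is what makes the prefix g
readable in the folded graph. *)
Lemma cycred_aut n (phi : aut n) (w : fgroup n) : cyc_reduced w ->
  exists c : fgroup n, [/\ fword c = cycred (phi w), cyc_reduced c &
    exists2 g : fgroup n, phi w = g * c * g^-1 & fword (phi w) = g ++ c ++ winv g].
Proof.
by move=> cw; apply: cycred_conj; rewrite -(aut1 phi) (inj_eq (@aut_inj _ phi)) cyc_neq1.
Qed.

Section Bridge.
Variables (n : nat) (phi : aut n) (u : fgroup n).
Hypothesis u1 : u != 1.
Implicit Types (a b v w z A B : fgroup n).

Lemma aut_surj a : exists b, phi b = a.
Proof. by have [psi _ k] := aut_bij phi; exists (psi a). Qed.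

Lemma between_pos A v x : between A (A * v) x -> exists i : vert (seg v), pos i = A^-1 * x.
Proof.
rewrite between_prefix1 mulKg => h.
have hs : size (A^-1 * x) < (size v).+1 by rewrite ltnS (size_prefix h).
exists (Ordinal hs); apply: fword_inj; rewrite fword_wprod; last first.
  by rewrite /reduced take_sorted // -/(reduced _) fwordP.
by move: h; rewrite prefixE => /eqP.
Qed.

Lemma pos_between A v (i : vert (seg v)) : between A (A * v) (A * pos i).
Proof. by have := between_take A (A * v) i; rewrite mulKg. Qed.

Lemma seg_hom_last v t (f : hom (seg v) (seg t)) :
  pos (hv f ord_max) = pos (hv f ord0) * v.
Proof. by rewrite hom_pos pos_max wprodK. Qed.

(** The positions of 1 and u on the segment from phi a to phi (a v) are the
ends of the image of u. *)
Lemma across_hom a v : across u (phi a) (phi (a * v)) ->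
  exists f : hom (seg u) (seg (phi v)), pos (hv f ord0) = (phi a)^-1.
Proof.
rewrite gmulfM => /(acrossP u1)[/between_pos[i ei] /between_pos[j ej]].
have [] := walk_seg_hom (@seg_walkP _ (phi v) i j u (fwordP _) _).
  by rewrite ei ej mulg1.
by move=> f [fi _]; exists f; rewrite fi ei mulg1.
Qed.

Lemma hom_across a v (f : hom (seg u) (seg (phi v))) :
  pos (hv f ord0) = (phi a)^-1 -> across u (phi a) (phi (a * v)).
Proof.
move=> e; apply/(acrossP u1); rewrite gmulfM.
split; first by have := pos_between (phi a) (hv f ord0); rewrite e mulgV.
by have := pos_between (phi a) (hv f ord_max); rewrite seg_hom_last e mulVKg.
Qed.

(** The ideal preimage ip comes from the segment (p.1, p.2): the map u -> phi(v)
places [1, u] relatively to the image of p.1. *)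
Definition at_segment (ip : ideal_preimage phi u) (p : fgroup n * fgroup n) :=
  p.1 * base ip = p.2 /\ pos (hv (Defs.pmap ip) ord0) = (phi p.1)^-1.

(** A morphism from v to a longer word w is a segment [A, A w] containing
[a, a v], and the position of [1, u] in its image is the required morphism. *)
Lemma force_ideal a b : force phi u a b ->
  exists ip : ideal_preimage phi u, at_segment ip (a, b).
Proof.
move=> fo; pose v := a^-1 * b; have eb : b = a * v by rewrite mulVKg.
have v1 : v != 1.
  by apply/eqP => e; case: fo => + _; apply; rewrite eb e mulg1.
have [f ef] : exists f : hom (seg u) (seg (phi v)), pos (hv f ord0) = (phi a)^-1.
  by apply: across_hom; rewrite -eb; apply: force_across.
have id w : w != 1 -> forall g : hom (seg v) (seg w),
    exists h : hom (seg u) (seg (phi w)), compatible_uword f h g.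
  move=> w1 g.
  (* the vertex where w starts when v is placed on [a, a v] *)
  pose A := a * (pos (hv g ord0))^-1.
  have [h eh] : exists h : hom (seg u) (seg (phi w)), pos (hv h ord0) = (phi A)^-1.
    apply: across_hom; case: fo => _; apply.
      by have := pos_between A (hv g ord0); rewrite /A mulgVK.
    by have := pos_between A (hv g ord_max); rewrite seg_hom_last mulgA /A mulgVK -eb.
  exists h; apply/compatible_uwordP; rewrite ef eh -autV -gmulfM -autV.
  by rewrite /A invgM invgK.
by exists (IdealPreimage v1 id); split; rewrite //= -eb.
Qed.

Lemma ideal_force (ip : ideal_preimage phi u) :
  exists a, at_segment ip (a, a * base ip) /\ force phi u a (a * base ip).
Proof.
have [a ea] := aut_surj (pos (hv (Defs.pmap ip) ord0))^-1.
have ef : pos (hv (Defs.pmap ip) ord0) = (phi a)^-1 by rewrite ea invgK.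
exists a; split=> //; split.
  by move/esym/eqP; rewrite -[X in _ == X]mulg1 (inj_eq (mulgI a)) (negbTE (base_neq1 ip)).
move=> A B oa ob; pose w := A^-1 * B.
have eB : B = A * w by rewrite mulVKg.
rewrite eB in oa ob *.
have [i ei] := between_pos oa; have [j ej] := between_pos ob.
have W : walk i (base ip) j.
  by apply: seg_walkP; rewrite ?fwordP // ei ej mulgA.
have [g [gi _]] := walk_seg_hom W.
have w1 : w != 1.
  apply: contra (base_neq1 ip) => /eqP w1.
  have hs : size w = 0 by rewrite w1.
  have P0 (k : vert (seg w)) : pos k = 1.
    by apply: pos0; have := ltn_ord k; rewrite [X in _ < X.+1]hs; case: (nat_of_ord k).
  by move: ej; rewrite !P0 mulgA -ei P0 mul1g => <-.
have [h /compatible_uwordP] := pmap_ideal w1 g.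
rewrite gi ei ef -autV -gmulfM mulgK autV => /esym.
exact: hom_across.
Qed.

Section Circle.
Variables (w s : fgroup n) (c : hom (circ s) (tF phi (circ w))) (h : hom (seg u) (circ s)).
Hypotheses (cw : cyc_reduced w) (cs : cyc_reduced s).

Let o : vert (tF phi (circ w)) := tF_vertex phi (circ_origin cw).

Let fT := @tF_folded n phi (circ w).

Lemma tF_circ_conn (y : vert (tF phi (circ w))) : exists t : fgroup n, walk o t y.
Proof. by apply: tF_conn => x; exists (take x w); apply: circ_walk_take. Qed.

(** An element read in tF phi (circ w) between images of vertices of the circle is
the image of an element read in the circle. *)
Lemma tF_circ_dev0 i (p : fgroup n) : walk o p (tF_vertex phi i) ->
  exists2 q, p = phi q & walk (circ_origin cw) q i.
Proof.
move/tF_circ_dev => [q pq]; rewrite take0 wprod_nil aut1 mul1g -gmulfM => ->.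
rewrite wprodK in pq; exists (q * wprod (take i w)) => //.
apply: walkM; [exact: circ_folded| exact: circ_power_loop |].
apply: walk_wprod; [exact: circ_folded| exact: circ_walk_take].
Qed.

Lemma tF_circ_loop (p : fgroup n) : walk o p o -> exists2 q, is_power w q & p = phi q.
Proof.
move/tF_circ_dev => [q]; rewrite take0 wprod_nil aut1 mul1g mulg1 wprodK => pq ->.
by exists q.
Qed.

(** The vertex z is chosen so that the image of u by c \o h is [1, u] when the origin
of circ w is placed at z.  The word read around the circle s from the image
of u is then a conjugate of s whose axis contains [1, u], and it lies in the
image of the conjugate by z of the group of powers of w. *)
Lemma circle_axis : exists z, image_axis phi u w z /\
  forall a v (f : hom (seg u) (seg (phi v))), pos (hv f ord0) = (phi a)^-1 ->
    (exists g : hom (seg v) (circ w), compatible f c h g) <-> on_axis w z (a, a * v).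
Proof.
set y := hv c (hv h ord0).
have [t ht] := tF_circ_conn y; have [z ez] := aut_surj t^-1.
exists z; split.
  set i := hv h ord0; set p := wprod (take i s).
  have hp : walk (circ_origin cs) p i by apply: walk_wprod; [exact: circ_folded|exact: circ_walk_take].
  have : walk i (p^-1 * s * p) i.
    have fs := circ_folded cs; exact: (walkM fs (walkM fs (walkV hp) (circ_walk cs)) hp).
  move/(walk_hom c) => hl.
  have [q pq eq] := tF_circ_loop (walkM fT (walkM fT ht hl) (walkV ht)).
  exists s, p, q; split=> //.
  - exact: axis_take.
  - by apply: walk_axis => //; apply: (walk_hom h (seg_walk u)).
  - by rewrite !gmulfM autV ez invgK -eq !mulgA mulVg mul1g mulgVK.
move=> a v f ef; rewrite /on_axis /=; split.
  case=> g /compatibleP; rewrite ef => hg.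
  have hg' := walkM fT ht (walkV hg); rewrite invgK in hg'.
  have [q eq hq] := tF_circ_dev0 hg'.
  have {}eq : z^-1 * a = q by apply: (@aut_inj _ phi); rewrite gmulfM autV ez invgK.
  split; apply/(axisP cw); first by exists (hv g ord0); rewrite eq.
  exists (hv g ord_max); rewrite mulgA eq; apply: walkM hq _; first exact: circ_folded.
  exact: (walk_hom g (seg_walk v)).
rewrite mulgA => -[h1 h2]; have [x [x' [w1 _ w2]]] := axis_walk cw h1 h2.
have [g [gx _]] := walk_seg_hom w2; exists g; apply/compatibleP; rewrite ef gx.
have := tF_walk phi w1; rewrite wprodK => w3.
have := walkM fT (walkV w3) ht.
by rewrite gmulfM autV ez invgK invgM mulgVK.
Qed.

End Circle.

Lemma hiso_seg v v' (g : hom (seg v) (seg v')) : hiso g ->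
  (pos (hv g ord0) = 1 /\ v = v') \/ (pos (hv g ord0) = v' /\ v = v'^-1).
Proof.
case=> -[g' k1 k2] _.
have es : size v = size v'.
  have /= := bij_eq_card (Bijective k1 k2); rewrite !card_ord; lia.
have e := seg_hom_last g; move: e; set i := hv g ord0; set j := hv g ord_max.
have li := ltn_ord i; have lj := ltn_ord j; rewrite !ltnS in li lj.
have D (k l : vert (seg v')) : k <= l -> size ((pos k)^-1 * pos l) = (l - k)%N.
  move=> kl; have r m : reduced (take m v') by rewrite /reduced take_sorted // -/(reduced _) fwordP.
  have ll : l <= size v' by rewrite -ltnS ltn_ord.
  rewrite prefix_fword; rewrite !fword_wprod // ?size_drop ?size_takel ?(leq_trans kl) //.
  by rewrite prefixE size_takel ?(leq_trans kl) // take_takel // eqxx.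
case: (leqP i j) => ij e.
  have := D i j ij; rewrite e mulKg es => ev.
  have i0 : i = 0 :> nat by lia.
  have jm : j = ord_max by apply: val_inj => /=; lia.
  left; rewrite pos0 //; split=> //.
  by move: e; rewrite jm pos_max pos0 // mul1g wprodK.
have := D j i (ltnW ij); rewrite -sizeV invgM invgK e mulKg es => ev.
have j0 : j = 0 :> nat by lia.
have im : i = ord_max by apply: val_inj => /=; lia.
right; move: e; rewrite im pos_max pos0 // wprodK => /esym/mulg1_eq.
by move=> <-.
Qed.

(** The representative of the base word of ip may be either orientation of v',
whence the two cases. *)
Lemma compatible_segments v v' a (f : hom (seg u) (seg (phi v)))
    (e : hom (seg v) (seg v')) ip p A :
  at_segment ip p -> pos (hv f ord0) = (phi a)^-1 -> compatible_along f e ip ->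
  A = a * (pos (hv e ord0))^-1 ->
  p = (A, A * v') \/ p = (A * v', A).
Proof.
case: p => p1 p2 [/= <- e1] ef [g /hiso_seg hg /compatible_uwordP].
rewrite ef e1 /= hom_pos -autV -gmulfM -autV => /(@aut_inj _ phi)/(congr1 inv).
rewrite !invgM !invgK => <- ->.
case: hg => -[-> ev]; first by left; rewrite invg1 mulg1 -ev.
by right; congr (_, _); rewrite !mulgA ?mulgVK // -ev.
Qed.

Variables (k : nat) (S : seq (fgroup n * fgroup n)).

Lemma orient_mem p A B : full_list phi u S -> p \in S -> p = (A, B) \/ p = (B, A) ->
  orient phi u (A, B) \in S.
Proof.
move=> [_ hS _] pS; have [_ h1 h2] := hS p pS.
case=> ep; rewrite ep /= in h1 h2; rewrite /orient /=; first by rewrite h1 -ep.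
have -> : beyond u (phi A) = false.
  by apply/negP => h; rewrite (beyond_before u1 h) in h2.
by rewrite -ep.
Qed.

Variable (ip : 'I_(size S) -> ideal_preimage phi u).
Hypotheses (fS : full_list phi u S)
  (hip : forall i, at_segment (ip i) (tnth (in_tuple S) i)).

Let SiS i : tnth (in_tuple S) i \in S.
Proof. exact: mem_tnth. Qed.

(** An isomorphism between base words identifies the unordered segments, and
the orientation fixed by [full_list] identifies the ordered ones. *)
Lemma preimages_distinct : preimage_set ip.
Proof.
move=> i j [g /hiso_seg hg /compatible_uwordP].
have [uS hS _] := fS.
suff E : tnth (in_tuple S) i = tnth (in_tuple S) j -> i = j.
  move: (hip i) (hip j) (hS _ (SiS i)) (hS _ (SiS j)) E.
  case: (tnth _ i) => a b; case: (tnth _ j) => a' b' [/= eb1 ->] [/= eb2 ->] [_ h1 h2] [_ h3 h4] E.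
  rewrite -!autV -gmulfM => /(@aut_inj _ phi)/(congr1 inv); rewrite invgM !invgK.
  case: hg => -[-> eb].
    by rewrite invg1 mulg1 => ea; apply: E; rewrite -eb1 -eb2 ea eb.
  move=> ea; have ea' : a = b' by rewrite -eb2 -ea mulgVK.
  by move: h4; rewrite -ea' (beyond_before u1 h1).
move=> E; apply: val_inj => /=; apply/eqP.
have a0 : fgroup n * fgroup n := (1, 1).
by rewrite -(nth_uniq a0 (ltn_ord i) (ltn_ord j) uS) -!(tnth_nth a0 (in_tuple S)) E.
Qed.

Lemma preimages_full : full_set ip.
Proof.
split=> [|w cw c _ h]; first exact: preimages_distinct.
have [s [es cs _]] := cycred_aut phi cw.
rewrite -es in c h *.
have [z [hz hf]] := circle_axis c h cw cs.
have [_ _ lS] := fS; have [p [pS pl pu]] := lS w z cw hz.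
have P i : (exists g : hom (seg (base (ip i))) (circ w), compatible (Defs.pmap (ip i)) c h g) <->
    on_axis w z (tnth (in_tuple S) i).
  have := hip i; case: (tnth _ i) => a b [/= <- e]; exact: hf.
have [i ei] : exists i, p = tnth (in_tuple S) i by apply/tnthP.
exists i; split; first by apply/P; rewrite -ei.
move=> j /P /(pu _ (SiS j)); rewrite ei => E.
have [uS _ _] := fS; apply: val_inj => /=; apply/eqP.
by rewrite -(nth_uniq p (ltn_ord i) (ltn_ord j) uS) -!(tnth_nth p (in_tuple S)) E.
Qed.

(** A full paradigm of continuations v x is a paradigm of the list at (a, a v),
and one of continuations x v is a paradigm at (a v, a). *)
Lemma preimages_minimal : (forall a b, ~ paradigm phi u S a b) ->
  ~ contains_full_paradigm ip.
Proof.
move=> np [v [f v1 hf]].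
have [a ea] := aut_surj (pos (hv f ord0))^-1.
have ef : pos (hv f ord0) = (phi a)^-1 by rewrite ea invgK.
have ne : a <> a * v.
  by move/esym/eqP; rewrite -[X in _ == X]mulg1 (inj_eq (mulgI a)) (negbTE v1).
have ac := hom_across ef.
case: hf => hf.
  apply: (np a (a * v)); split=> // c; rewrite mulKg => /hf [i [e e0 hc]].
  have := compatible_segments (hip i) ef hc (erefl _).
  rewrite e0 pos0 // invg1 mulg1 mulgA => H.
  exact: (orient_mem fS (SiS i) H).
apply: (np (a * v) a); split; first by move=> h; apply: ne.
  by rewrite across_sym.
move=> c; have -> : (a * v)^-1 * a * gen c = (gen (linv c) * v)^-1.
  by rewrite gen_linv !invgM invgK mulgVK.
have -> : (a * v)^-1 * a = v^-1 by rewrite invgM mulgVK.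
rewrite !sizeV => /hf [i [e e0 hc]].
have := compatible_segments (hip i) ef hc (erefl _).
have -> : pos (hv e ord0) = gen (linv c).
  apply: (mulIg v); rewrite -(seg_hom_last e) e0 pos_max wprodK //.
rewrite gen_linv invgK !mulgA mulgK => H.
apply: (orient_mem fS (SiS i)); case: H => ->; by [right|left].
Qed.

End Bridge.

(** * Existence of minimal full sets *)

Section Existence.
Variables (n : nat) (phi : aut n) (u : fgroup n).
Hypotheses (hn : 1 < n) (u1 : u != 1).

Lemma minimal_full_set_exists :
  exists k (S : 'I_k -> ideal_preimage phi u), minimal_full_set S.
Proof.
have [S fS mS] := minimal_list_exists phi u1 hn.
have : forall i : 'I_(size S), exists ip : ideal_preimage phi u,
    at_segment ip (tnth (in_tuple S) i).
  move=> i; have [_ hS _] := fS; have [h _ _] := hS _ (mem_tnth i (in_tuple S)).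
  by have [ip hip] := force_ideal u1 h; exists ip; move: hip; rewrite -surjective_pairing.
move/choice => [ip hip]; exists (size S), ip; split.
  exact: preimages_full.
exact: preimages_minimal fS hip mS.
Qed.

End Existence.

(** * The embedded circle *)

Section CircleInclusion.
Variable n : nat.
Implicit Types (s w : fgroup n).

Lemma walk_circ_hom (G : lgraph n) (x : vert G) (s : seq (letter n)) :
  walk x s x -> exists f : hom (circ s) G, forall i : vert (circ s), i = 0 :> nat -> hv f i = x.
Proof.
move/walk_vs => [vs [v0 vm h]].
have : forall i : 'I_(size s), exists e : edge G,
    [/\ init e = vs i, lab e = tnth (in_tuple s) i & term e = vs (ordS i)].
  move=> i; have [e [h1 h2 h3]] := h (tnth (in_tuple s) i) i (ltn_ord i).
  exists e; split=> //; first by rewrite h2 [RHS](tnth_nth (tnth (in_tuple s) i)).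
  rewrite h3 /=; case: (ltnP i.+1 (size s)) => hi; first by rewrite modn_small.
  have -> : i.+1 = size s by apply/eqP; rewrite eqn_leq hi ltn_ord.
  by rewrite modnn vm v0.
move/choice => [E hE].
pose he (e : 'I_(size s) * bool) := if e.2 then E e.1 else einv (E e.1).
have P1 (e : edge (circ s)) : init (he e) = vs (init e).
  by case: e => i []; rewrite /he /=; case: (hE i).
have P2 (e : edge (circ s)) : he (einv e) = einv (he e).
  by case: e => i []; rewrite /he //= einvK.
have P3 (e : edge (circ s)) : lab (he e) = lab e.
  by case: e => i []; rewrite /he /= /wlab /= ?lab_einv; case: (hE i) => _ ->.
exists (@Hom _ (circ s) G (fun i => vs i) he P1 P2 P3).
by move=> i /= ->.
Qed.

(** A nontrivial conjugate of a power of a cyclically reduced word is at least as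
long as that word: compare the lengths of large powers. *)
Lemma conj_size s (q g h : fgroup n) : cyc_reduced s -> is_power s h -> q = g * h * g^-1 -> q != 1 -> size s <= size q.
Proof.
move=> cs ph eq q1.
have key (v : fgroup n) k : cyc_reduced v -> size v = size s -> h = v ^+ k -> size s <= size q.
  move=> cv sv eh; case: k eh => [|k] eh.
    by move: q1; rewrite eq eh expg0 mulg1 mulgV eqxx.
  rewrite leqNgt; apply/negP => lt.
  (* conjugating by g changes the length of q^K by at most 2 size g, whereas a *)
  (* q shorter than s would make q^K shorter than h^K by at least K letters    *)
  pose K := (2 * size g).+1.
  have eK : q ^+ K = g * h ^+ K * g^-1 by rewrite eq conjX.
  have : size (h ^+ K) <= size (q ^+ K) + 2 * size g.
    have -> : h ^+ K = g^-1 * (q ^+ K * g) by rewrite eK mulgVK !mulgA mulVg mul1g.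
    apply: leq_trans (sizeM _ _) _.
    rewrite sizeV addnC mul2n -addnn addnA leq_add2r; exact: sizeM.
  have sq l : size (q ^+ l) <= l * size q.
    elim: l => // l IH; rewrite expgS mulSn.
    by apply: leq_trans (sizeM _ _) _; rewrite leq_add2l.
  rewrite eh -expgnA (size_cycX _ cv) sv; have := sq K.
  have : K * (size q).+1 <= k.+1 * K * size s.
    by rewrite -mulnA mulSn; apply: leq_trans (leq_addr _ _); rewrite leq_mul2l lt orbT.
  rewrite /K mulnS; lia.
case: ph => k [eh|eh]; first exact: key eh.
by apply: key eh; rewrite ?cyc_reducedV // sizeV.
Qed.

Variable phi : aut n.

(** As phi w is literally g s g^-1 with s cyclically reduced, s is read around a
loop of tF phi (circ w).  If two vertices of the loop were identified, a proper
subword of s would be conjugate to a power of s, contradicting [conj_size]. *)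
Lemma circ_incl_exists w : cyc_reduced w ->
  exists c : hom (circ (cycred (phi w))) (tF phi (circ w)), circ_incl c.
Proof.
move=> cw.
have [s [es cs [g _ eg]]] := cycred_aut phi cw; rewrite /circ_incl -es.
pose o := tF_vertex phi (circ_origin cw).
have fT := @tF_folded n phi (circ w).
have := tF_walk phi (circ_walk cw); rewrite wprodK -/o => ho.
have [x hx] : exists x : vert (tF phi (circ w)), walk x s x.
  move: ho; rewrite eg => /walk_cat[x [h1 /walk_cat[y [h2 h3]]]].
  have := walk_winv h3; rewrite winvK => h4.
  by exists x; rewrite -(walk_fun fT h1 h4) in h2.
have [f _] := walk_circ_hom hx; exists f.
have key (i j : vert (circ s)) : i < j -> hv f i = hv f j -> False.
  move=> lt e; pose q : fgroup n := (wprod (take i s))^-1 * wprod (take j s).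
  have r m : reduced (take m s) by rewrite /reduced take_sorted // -/(reduced _) fwordP.
  have sq : size q = (j - i)%N.
    rewrite prefix_fword; rewrite !fword_wprod // ?size_drop ?size_takel ?(ltnW (ltn_ord _)) //.
    by rewrite prefixE size_takel ?(ltnW (ltn_ord _)) // take_takel ?eqxx // ltnW.
  have q1 : q != 1 by rewrite -size_gt0 sq subn_gt0.
  have fs := circ_folded cs.
  have W (m : vert (circ s)) : walk (circ_origin cs) (wprod (take m s)) m by apply: walk_wprod; [|exact: circ_walk_take].
  have := walk_hom f (walkM fs (walkV (W i)) (W j)); rewrite -/q -e => hq.
  have [t ht] := tF_circ_conn cw (hv f i).
  have [h ph eh] := tF_circ_loop (walkM fT (walkM fT ht hq) (walkV ht)).
  have ps : is_power (phi w) (phi h).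
    by case: ph => l [->|->]; exists l; [left|right]; rewrite autX ?autV.
  have [g' eg'] : exists g' : fgroup n, phi w = g' * s * g'^-1.
    have [s' [es' _ [g' eg' _]]] := cycred_aut phi cw; exists g'.
      by rewrite eg'; congr (_ * _ * _); apply: fword_inj; rewrite es' es.
  have [h' ph' eh'] : exists2 h', is_power s h' & phi h = g' * h' * g'^-1.
    have eV : (g' * s * g'^-1)^-1 = g' * s^-1 * g'^-1 by rewrite !invgM invgK mulgA.
    case: ps => l []; rewrite eg' ?eV conjX => ->.
      by exists (s ^+ l) => //; exists l; left.
    by exists (s^-1 ^+ l) => //; exists l; right.
  have := conj_size (q := q) (g := t^-1 * g') cs ph'; rewrite sq => H.
  have : size s <= j - i.
    by apply: H => //; rewrite invgM invgK !mulgA -(mulgA _ g') -(mulgA t^-1) -(mulgA t^-1) -eh' -eh !mulgA mulVg mul1g mulgVK.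
  by have := ltn_ord j; lia.
have injv : injective (hv f).
  move=> i j e; apply: val_inj; case: (ltngtP i j) => // lt; last by case: (key j i lt (esym e)).
  by case: (key i j lt e).
split=> // e e' ee; apply: (circ_folded cs); last by rewrite -(hom_lab f e) ee hom_lab.
by apply: injv; rewrite -!hom_init ee.
Qed.

End CircleInclusion.

(** * Occurrence of u in the image of a cyclic word *)

Section Transfer.
Variables (n : nat) (phi : aut n) (u : fgroup n).
Hypothesis u1 : u != 1.

(** The axis of w through the base word contains arbitrarily long segments
extending it, whose images contain [1, u]; by [axis_between] so does the axis
of the image of w. *)
Lemma ideal_readable (w s : fgroup n) (ip : ideal_preimage phi u) x y :
  cyc_reduced w -> fword s = cycred (phi w) ->
  walk (x : vert (circ w)) (base ip) y -> exists i j : vert (circ s), walk i u j.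
Proof.
move=> cw es hw.
have [s' [es' cs [g eg _]]] := cycred_aut phi cw.
have {es' es} ss : s' = s by apply: fword_inj; rewrite es' es.
subst s'.
have [a [_ [_ fo]]] := ideal_force u1 ip.
set b := a * base ip in fo.
have [z [la lb]] : exists z : fgroup n, axis w (z^-1 * a) /\ axis w (z^-1 * b).
  exists (a * (wprod (take x w))^-1); rewrite invgM invgK.
  split; first by rewrite mulgVK; apply: axis_take.
  by rewrite mulgA mulgVK; apply: walk_axis hw.
pose p : fgroup n := (phi z * g)^-1.
pose k := (size (z^-1 * a) + size (z^-1 * b) + size p + size (p * u) + size g).+1.
have O t : axis w (z^-1 * t) -> size (z^-1 * t) < k -> between (z * w^-1 ^+ k) (z * w ^+ k) t.
  move=> lt ht; rewrite -(between_mul z^-1) !mulKg.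
  have := @axis_between _ w 1 (z^-1 * t) k cw; rewrite !mulg1 => H; apply/H => //.
  by rewrite addn0.
have : across u (phi (z * w^-1 ^+ k)) (phi (z * w ^+ k)).
  by apply: fo; apply: O => //; rewrite /k; lia.
have eV : phi w^-1 = g * s^-1 * g^-1 by rewrite autV eg !invgM invgK mulgA.
rewrite !gmulfM !autX eg eV !conjX => /(acrossP u1) [].
have T v t : between (phi z * (g * s^-1 ^+ k * g^-1)) (phi z * (g * v * g^-1)) t ->
    between (s^-1 ^+ k * g^-1) (v * g^-1) (p * t).
  by rewrite -(between_mul p) /p !invgM !mulgA !mulgVK !mulVg !mul1g.
move=> /T; rewrite mulg1 => h1 /T h2.
have P (t : fgroup n) : size t + size g^-1 < k -> between (s^-1 ^+ k * g^-1) (s ^+ k * g^-1) t -> axis s t.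
  by move=> ht h; apply/(axis_between cs ht).
have [] := @axis_walk _ s cs p u; first by apply: P h1; rewrite sizeV /k; lia.
  by apply: P h2; rewrite sizeV /k; lia.
by move=> i [j [_ _ h]]; exists i, j.
Qed.

End Transfer.

(** * Words read along a circle *)

Section Reading.
Variable n : nat.
Implicit Types (c d : letter n) (s t : seq (letter n)).

(** The edge following e when the circle is traversed without backtracking. *)
Definition circ_step s (e : edge (circ s)) : edge (circ s) :=
  if e.2 then (ordS e.1, true) else (ord_pred e.1, false).

Lemma circ_stepP s (e e' : edge (circ s)) :
  init e' = term e -> e' <> einv e -> e' = circ_step e.
Proof.
case: e e' => i [] [j []] /=; rewrite /circ_step /term /= /circ_init /=.
- by move=> ->.
- by move/ordS_inj => ->.
- by move=> -> [].
- by move=> <-; rewrite ordSK.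
Qed.

Lemma circ_read s (x y : vert (circ s)) c t : reduced (c :: t) -> walk x (c :: t) y ->
  exists e : edge (circ s), c :: t = map (@lab _ (circ s)) (traject (@circ_step s) e (size t).+1).
Proof.
move=> rt [e [_ ec h]] {x}; exists e; rewrite trajectS map_cons -ec; congr (_ :: _).
elim: t c e rt ec h => [|d t IH] c e rt ec // [e' [h1 h2 h3]].
have ee : e' = circ_step e.
  apply: circ_stepP => // E; move: rt; rewrite /reduced /= -h2 E lab_einv ec.
  by rewrite eqxx.
subst e'; rewrite trajectS map_cons h2; congr (_ :: _).
by apply: (IH d) => //; apply: reduced_behead rt.
Qed.

(** Words in the generators only, or in their inverses only. *)
Definition signed (b : bool) s := all (fun c => c.2 == b) s.

Lemma signed_cyc b s : s != [::] -> signed b s -> cyc_reduced s.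
Proof.
have P c t : signed b (c :: t) -> path (fun a d => d != linv a) c t.
  elim: t c => //= d t IH c /and3P[hc hd ht].
  rewrite IH /= ?hd ?ht // andbT; apply: contraTneq hd => ->.
  by rewrite /= (eqP hc); case: (b).
case: s => // c t _ h; rewrite /cyc_reduced /=; apply: P.
by move: h; rewrite /signed /= all_rcons => /andP[-> ->].
Qed.

Lemma lab_signed s (e : edge (circ s)) : signed true s -> (lab e).2 = e.2.
Proof.
move=> hs; have H i : (tnth (in_tuple s) i).2 = true.
  by move/allP: hs => /(_ _ (mem_tnth i (in_tuple s)))/eqP.
by case: e => i [] /=; rewrite /wlab /= H.
Qed.

Lemma circ_step_sign s (e : edge (circ s)) : (circ_step e).2 = e.2.
Proof. by case: e => i []. Qed.

Lemma read_signed s (x y : vert (circ s)) t : signed true s -> reduced t -> walk x t y ->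
  signed true t \/ signed false t.
Proof.
move=> hs; case: t => [|c t]; first by left.
move=> rt /(circ_read rt)[e ->].
have : signed e.2 (map (@lab _ (circ s)) (traject (@circ_step s) e (size t).+1)).
  elim: (_.+1) e => //= k IH e.
  rewrite /signed /= -/(signed _ _) lab_signed // eqxx /=.
  by rewrite -(circ_step_sign e); apply: IH.
by case: (e.2); [left|right].
Qed.

Lemma read_alternate (c1 c2 : letter n) (x y : vert (circ [:: c1; c2])) t :
  c1.1 != c2.1 -> reduced t -> walk x t y -> sorted (fun c d => c.1 != d.1) t.
Proof.
move=> ne; case: t => // c t rt /(circ_read rt)[e ->] /=.
elim: (size t) e => //= k IH e; rewrite IH andbT.
have ne' : c2.1 != c1.1 by rewrite eq_sym.
by case: e => [[[|[|m]] hm] []] //=; rewrite /wlab /= /tnth /=.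
Qed.

End Reading.

(** * Products of conjugates of two generators *)

Section Generators.
Variable n : nat.
Implicit Types (c d : letter n) (s t : seq (letter n)) (p q g : fgroup n) (i j : 'I_n).

Local Notation x i := (gen (i, true) : fgroup n).

Lemma letter_cyc c : cyc_reduced (gen c).
Proof. by apply: (@signed_cyc _ c.2); rewrite //= eqxx. Qed.

Lemma reduced_nseq k c : reduced (nseq k c).
Proof. by elim: k => // -[|k] //= IH; rewrite /reduced /= eq_sym linv_neq. Qed.

Lemma fword_genX k c : fword (gen c ^+ k) = nseq k c.
Proof. by elim: k => // k IH; rewrite cycXS ?letter_cyc // IH. Qed.

Lemma wprod_nseq k c : wprod (nseq k c) = gen c ^+ k.
Proof. by rewrite -fword_genX wprodK. Qed.

Lemma is_power_genP i p : is_power (x i) p -> exists b k, p = gen (i, b) ^+ k.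
Proof. by case=> k [->|->]; [exists true, k|exists false, k; rewrite -gen_linv]. Qed.

Lemma is_power_gen i b k : is_power (x i) (gen (i, b) ^+ k).
Proof. by exists k; case: b; [left|right; rewrite -gen_linv]. Qed.

Definition head_index s := ohead (map fst s).

Lemma diverge_head_index s t : head_index s <> head_index t -> diverge s t.
Proof.
case: s t => [|c s] [|d t] //= h; apply: contra_notN h => /eqP -> //.
Qed.

(** Powers of the i-th generator are split off on the left and powers of the
j-th one on the right until none remains. *)
Lemma double_coset i j t : exists p q g,
  [/\ wprod t = p * g * q, is_power (x i) p, is_power (x j) q, head_index g <> Some i & head_index (winv g) <> Some j].
Proof.
suff H k (v : fgroup n) : size v <= k -> exists p q g,
  [/\ v = p * g * q, is_power (x i) p, is_power (x j) q, head_index g <> Some i & head_index (winv g) <> Some j].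
  exact: H (leqnn _).
elim: k v => [|k IH] v hk.
  exists 1, 1, 1; rewrite !mulg1; split; try exact: is_power1; try by [].
  by apply: size0_eq1; apply/eqP; rewrite -leqn0.
case: (pselect (head_index v = Some i)) => [hi|hi].
  case E : (fword v) hi hk => [|[i' b] s] //= [ei] hk; subst i'.
  have rs : reduced s by have := fwordP v; rewrite E => /reduced_behead.
  have [|p [q [g [eg hp hq h1 h2]]]] := IH (wprod s); first by rewrite fword_wprod.
  exists (gen (i, b) * p), q, g; split=> //.
    by rewrite -[v]wprodK E wprod_cons eg !mulgA.
  by apply: is_powerM => //; have := is_power_gen i b 1; rewrite expg1.
case: (pselect (head_index (winv v) = Some j)) => [hj|hj]; last first.
  by exists 1, 1, v; rewrite mulg1 mul1g; split=> //; exact: is_power1.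
have rv := fwordP v.
case/lastP E : (fword v) hj hk rv => [|s [j' b]] //; rewrite winv_rcons size_rcons => /= -[ej] hk rv.
subst j'.
have rs : reduced s by move: rv; rewrite -cats1 => /reduced_catl.
have [|p [q [g [eg hp hq h1 h2]]]] := IH (wprod s); first by rewrite fword_wprod.
exists p, (q * gen (j, b)), g; split=> //.
  by rewrite -[v]wprodK E wprod_rcons eg !mulgA.
by apply: is_powerM => //; have := is_power_gen j b 1; rewrite expg1.
Qed.

(** With g stripped as in [double_coset], nothing cancels in x^k1 g y^k2 g^-1,
even cyclically, for x and y different generators or inverses of generators. *)
Lemma lantern_cyc i j b1 b2 k1 k2 g : i != j -> 0 < k1 -> 0 < k2 ->
  head_index g <> Some i -> head_index (winv g) <> Some j ->
  cyc_reduced (nseq k1 (i, b1) ++ g ++ nseq k2 (j, b2) ++ winv g).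
Proof.
move=> ne k1p k2p h1 h2.
have nij : Some i <> Some j by case=> e; rewrite e eqxx in ne.
have W k c : winv (nseq k c) = nseq k (linv c).
  by rewrite /winv map_nseq rev_nseq.
have Hn k c s : 0 < k -> head_index (nseq k c ++ s) = Some c.1 by case: k.
have Hg s : head_index s <> Some i -> head_index (fword g ++ s) <> Some i.
  by case: (fword g) h1.
have d2 : diverge (winv (nseq k2 (j, b2))) (winv g).
  by apply: diverge_head_index; rewrite W -[nseq _ _]cats0 Hn //= => e; apply: h2.
have d1 : diverge (winv g) (nseq k2 (j, b2) ++ winv g).
  by apply: diverge_head_index; rewrite Hn.
have d0 : diverge (winv (nseq k1 (i, b1))) (g ++ nseq k2 (j, b2) ++ winv g).
  apply: diverge_head_index; rewrite W -[nseq k1 _]cats0 Hn //= => e; apply: (Hg _ _ (esym e)).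
  by rewrite Hn //= => -[e']; apply: nij; rewrite e'.
rewrite cyc_reducedE; apply/and3P; split.
- by case: (k1) k1p.
- by rewrite !reduced_cat !reduced_nseq reduced_winvE fwordP d2 d1 d0.
- apply: diverge_head_index; rewrite Hn // !winv_cat winvK -!catA => /= e; apply: (Hg _ _ (esym e)).
  by rewrite W Hn //= => -[e']; apply: nij; rewrite e'.
Qed.

End Generators.

(** * Automorphisms preserving axes up to translation are inner *)

Section Inner.
Variables (n : nat) (theta : fgroup n -> fgroup n).
Hypotheses (hn : 1 < n) (thM : {morph theta : p q / p * q}) (th_inj : injective theta).
Implicit Types (c d : letter n) (s t : seq (letter n)) (p q g r e w h : fgroup n) (i j : 'I_n).

Local Notation x i := (gen (i, true) : fgroup n).

Hypothesis conj_powers : forall w, cyc_reduced w ->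
  exists k g h, [/\ 0 < k, is_power w h & theta w ^+ k = g * h * g^-1].

Lemma theta1 : theta 1 = 1.
Proof. by apply: (mulgI (theta 1)); rewrite mulg1 -thM mulg1. Qed.

(** Elements with conjugate powers have the same axis up to translation, since
an element and its powers have the same axis. *)
Lemma axis_conj e w k g h : cyc_reduced e -> cyc_reduced w -> 0 < k ->
  e ^+ k = g * h * g^-1 -> is_power w h -> forall p, axis e p -> axis w (g^-1 * p).
Proof.
move=> ce cw k0 E ph p hp.
have h1 : h != 1.
  apply: contraTneq (size_cycX_ge k ce) => h1.
  by rewrite E h1 mulg1 mulgV -ltnNge.
pose K := (size p + size g + size (g^-1 * p)).+1.
have := @axis_between _ e g p (k * K) ce.
have -> : e ^+ (k * K) * g = g * h ^+ K by rewrite expgnA E conjX mulgVK.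
have -> : e^-1 ^+ (k * K) * g = g * h^-1 ^+ K.
  have EV : e^-1 ^+ k = g * h^-1 * g^-1 by rewrite expVgn E !invgM invgK mulgA.
  by rewrite expgnA EV conjX mulgVK.
rewrite -(between_mul g^-1) !mulKg => H.
have {H} : between (h^-1 ^+ K) (h ^+ K) (g^-1 * p).
  by apply/H => //; apply: leq_trans (leq_pmull _ k0); rewrite /K; lia.
have key (v : fgroup n) m : cyc_reduced v -> v ^+ m != 1 ->
    between (v^-1 ^+ m ^+ K) (v ^+ m ^+ K) (g^-1 * p) <-> axis v (g^-1 * p).
  move=> cv; case: m => [|m]; first by rewrite expg0 eqxx.
  rewrite -!expgnA => _; have := @axis_between _ v 1 (g^-1 * p) (m.+1 * K) cv; rewrite !mulg1 => H.
  by split => /H; apply; rewrite addn0 mulSn /K; lia.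
case: ph h1 => m [->|->] h1; first by rewrite -expVgn => /key; apply.
rewrite -expVgn invgK between_sym => H; apply/(key w m) => //.
by move: h1; rewrite expVgn invg_eq1.
Qed.

Lemma theta_axis w e r : cyc_reduced w -> cyc_reduced e -> theta w = r * e * r^-1 ->
  exists g, forall p, axis e p -> axis w (g * p).
Proof.
move=> cw ce E; have [k [g [h [k0 ph eg]]]] := conj_powers cw.
have ek : e ^+ k = (r^-1 * g) * h * (r^-1 * g)^-1.
  have -> : e = r^-1 * theta w * r^-1^-1 by rewrite E invgK !mulgA mulVg mul1g mulgVK.
  by rewrite conjX eg !invgM !invgK !mulgA.
by exists (r^-1 * g)^-1; apply: axis_conj ek ph.
Qed.

(** Every subword of a cyclically reduced conjugate of theta w is read around the
circle w, in one of the two directions. *)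
Lemma theta_read w e r (s t v : seq (letter n)) : cyc_reduced w -> cyc_reduced e ->
  theta w = r * e * r^-1 -> fword e = s ++ t ++ v -> exists i j : vert (circ w), walk i t j.
Proof.
move=> cw ce E; have [g hg] := theta_axis cw ce E; move=> ee.
have rt : reduced t by have := fwordP e; rewrite ee => /reduced_catr/reduced_catl.
have rs : reduced s by have := fwordP e; rewrite ee => /reduced_catl.
have rst : reduced (s ++ t) by have := fwordP e; rewrite ee catA => /reduced_catl.
have le : axis e e by have := axisX ce 1; rewrite expg1.
have [] := @axis_walk _ _ cw (g * wprod s) (wprod t).
- by apply/hg/(axis_prefix le); rewrite fword_wprod // ee prefix_prefix.
- rewrite -mulgA -wprod_cat; apply/hg/(axis_prefix le).
  by rewrite fword_wprod // ee catA prefix_prefix.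
by move=> i [j [_ _]]; rewrite fword_wprod // => h; exists i, j.
Qed.

Lemma theta_conj1 p : theta p = 1 -> p = 1.
Proof. by move=> e; apply: th_inj; rewrite theta1. Qed.

Lemma theta_gen i : exists r b k, 0 < k /\ theta (x i) = r * gen (i, b) ^+ k * r^-1.
Proof.
have cw := letter_cyc (i, true).
have t1 : theta (x i) != 1 by apply: contraNneq (cyc_neq1 cw) => /theta_conj1 ->.
have [e [_ ce [r er _]]] := cycred_conj t1.
have [g hg] := theta_axis cw ce er.
have L p : axis (x i) p -> is_power (x i) p.
  move=> /(axisP cw)[y /circ_dev[h ph]]; rewrite take0 wprod_nil mul1g wprodK => ->.
  have -> : y = 0 :> nat by case: y => -[].
  by rewrite take0 wprod_nil mulg1; rewrite wprodK in ph.
have g1 := L _ (hg _ (axis1 ce)).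
have g2 := L _ (hg e _); have {g2} : is_power (x i) e.
  rewrite mulg1 in g1; rewrite -(mulKg g e); apply: is_powerM; first exact: is_powerV.
  by apply: g2; have := axisX ce 1; rewrite expg1.
case/is_power_genP => b [k ek]; exists r, b, k; rewrite -ek; split=> //.
by case: k ek (cyc_neq1 ce) => // ->; rewrite expg0 eqxx.
Qed.

(** Write the inverse of r1 times r2 as p g q with g stripped.  Then theta (x y) is
conjugate to x^k1 g y^k2 g^-1, up to the signs b1 and b2, and this word is
cyclically reduced, so by [theta_read] it is read along the periodic word
x y x y ... or its inverse.  All its letters have the same sign, which
excludes a letter of g and its inverse in g^-1, and the two generators
alternate, so the exponents are 1. *)
Lemma theta_pair i j r1 r2 b1 b2 k1 k2 : i != j -> 0 < k1 -> 0 < k2 ->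
  theta (x i) = r1 * gen (i, b1) ^+ k1 * r1^-1 ->
  theta (x j) = r2 * gen (j, b2) ^+ k2 * r2^-1 ->
  [/\ b1 = b2, k1 = 1%N, k2 = 1%N &
    exists p q, [/\ is_power (x i) p, is_power (x j) q & r1^-1 * r2 = p * q]].
Proof.
move=> ne k1p k2p e1 e2.
have [p [q [g []]]] := double_coset i j (r1^-1 * r2); rewrite wprodK => eg pp pq h1 h2.
pose W := nseq k1 (i, b1) ++ g ++ nseq k2 (j, b2) ++ winv g.
have cW : cyc_reduced W by apply: lantern_cyc.
pose w := wprod [:: (i, true); (j, true)].
have cw0 : cyc_reduced [:: (i, true); (j, true)] by apply: (@signed_cyc _ true).
have fw : fword w = [:: (i, true); (j, true)] by rewrite fword_cyc.
have cw : cyc_reduced w by rewrite fw.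
have comm (y z : fgroup n) l : is_power z y -> y * z ^+ l * y^-1 = z ^+ l.
  move=> [m [->|->]]; first by rewrite -expgnDr addnC expgnDr mulgK.
  by rewrite (commuteX2 m l (commute_sym (commuteV (commute_refl z)))) mulgK.
have commb (y : fgroup n) i' b l : is_power (x i') y -> y * gen (i', b) ^+ l * y^-1 = gen (i', b) ^+ l.
  case: b => py; apply: comm => //; rewrite -[(i', false)]/(linv (i', true)) gen_linv.
  exact/is_power_inv.
have E : theta w = (r1 * p) * wprod W * (r1 * p)^-1.
  have er2 : r2 = r1 * (p * g * q) by rewrite -eg mulVKg.
  rewrite /w wprod_cons wprod1 thM e1 e2 er2 /W !wprod_cat !wprod_nseq wprod_winv !wprodK.
  rewrite -{1}(commb p i b1 k1 pp) -{2}(commb q j b2 k2 pq) !invgM !mulgA.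
  by rewrite !mulgVK.
have ce : cyc_reduced (wprod W) by rewrite fword_cyc.
have eW : fword (wprod W) = [::] ++ W ++ [::] by rewrite fword_cyc // cats0.
have := theta_read cw ce E eW; rewrite fw => -[y [z hW]].
have rW := cyc_red cW.
have alt := read_alternate (ne : (i, true).1 != (j, true).1) rW hW.
have [b hb] : exists b, signed b W.
  by have [] := read_signed (isT : signed true [:: (i, true); (j, true)]) rW hW => h; eexists; apply: h.
have g0 : fword g = [::].
  move: hb; rewrite /W /winv /signed !all_cat; case: (fword g) => // c u.
  rewrite map_cons rev_cons all_rcons /= => /and4P[_ /andP[/eqP hc _] _ /andP[/eqP hc' _]].
  by move: hc'; rewrite hc; case: (b).
have eg1 : g = 1 by apply: fword_inj.
have kk (c : letter n) k : 0 < k -> sorted (fun c d => c.1 != d.1) (nseq k c) -> k = 1%N.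
  by case: k => [|[|k]] //= _; rewrite eqxx.
split; last by exists p, q; rewrite eg eg1 mulg1.
- move: hb; rewrite /W g0 /signed !all_cat /=; case: (k1) k1p => // k1' _; case: (k2) k2p => // k2' _ /=.
  by rewrite !andbT => /andP[/andP[/eqP -> _] /andP[/eqP -> _]].
- by apply: (kk (i, b1)) => //; move: alt; rewrite /W => /cat_sorted2[].
- apply: (kk (j, b2)) => //; move: alt; rewrite /W g0 /winv /= cats0.
  by move=> /cat_sorted2[].
Qed.

Lemma is_power_gen_index i p : is_power (x i) p -> all (fun c => c.1 == i) p.
Proof.
move=> /is_power_genP[b [k ->]]; rewrite fword_genX; apply/allP => c /nseqP[-> _].
exact: eqxx.
Qed.

(** The word of q^-1 p is the concatenation of those of q^-1 and p, so a letter of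
p would be a letter of r. *)
Lemma is_power_gen_disjoint i j l p q r : i != j -> i != l -> is_power (x i) p -> is_power (x j) q -> is_power (x l) r ->
  q^-1 * p = r -> p = 1.
Proof.
move=> ij il /is_power_gen_index hp /is_power_gen_index hq /is_power_gen_index hr e.
apply: fword_inj; case Ep : (fword p) => [|c s] //; exfalso.
have d : diverge q p.
  move: hq hp; rewrite Ep; case: (fword q) => //= d t /andP[/eqP hd _] /andP[/eqP hc _].
  by apply: contraNneq ij => dc; rewrite -hd -hc dc.
move: hr; rewrite -e diverge_mul // all_cat Ep /= => /andP[_ /andP[hc _]].
by move: hp; rewrite Ep /= (eqP hc) eq_sym (negbTE il).
Qed.

(** The conjugators for the first two generators are made equal by
[theta_pair].  The conjugator of any other generator, compared with both, can
then only differ by a power of that generator. *)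
Lemma theta_gens : exists h b, forall i, theta (x i) = h * gen (i, b) * h^-1.
Proof.
pose i0 : 'I_n := Ordinal (ltnW hn); pose i1 : 'I_n := Ordinal hn.
have n01 : i0 != i1 by [].
have [r0 [b0 [k0 [k0p e0]]]] := theta_gen i0.
have [r1 [b1 [k1 [k1p e1]]]] := theta_gen i1.
have [eb ek0 ek1 [p [q [hp hq er]]]] := theta_pair n01 k0p k1p e0 e1.
subst b1 k0 k1; pose h := r0 * p.
have comm (y : fgroup n) j b : is_power (x j) y -> y * gen (j, b) * y^-1 = gen (j, b).
  have C : commute y (gen (j, b)) -> y * gen (j, b) * y^-1 = gen (j, b).
    by move=> ->; rewrite mulgK.
  move=> [m py]; apply: C.
  have cx : commute (x j) (gen (j, b)).
    by case: b; [|rewrite -[(j, false)]/(linv (j, true)) gen_linv; apply: commuteV].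
  by case: py => ->; apply/commute_sym/commuteX/commute_sym => //; apply/commute_sym/commuteV/commute_sym.
have H0 : theta (x i0) = h * gen (i0, b0) ^+ 1 * h^-1.
  by rewrite e0 !expg1 -{1}(comm p i0 b0 hp) /h invgM !mulgA.
have H1 : theta (x i1) = h * gen (i1, b0) ^+ 1 * h^-1.
  have -> : h = r1 * q^-1 by rewrite -[r1](mulKg r0^-1) invgK er /h -!mulgA mulgV mulg1.
  rewrite e1 !expg1 -{1}(comm q^-1 i1 b0 (is_powerV hq)) !invgM !invgK !mulgA.
  by [].
exists h, b0 => i.
case: (eqVneq i0 i) => [<-|n0]; first by rewrite H0 expg1.
case: (eqVneq i1 i) => [<-|n1]; first by rewrite H1 expg1.
have [r [b [k [kp e]]]] := theta_gen i.
have [eb _ _ [p0 [q0 [hp0 hq0 er0]]]] := theta_pair n0 (isT : 0 < 1) kp H0 e.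
have [_ _ ek' [p1 [q1 [hp1 hq1 er1]]]] := theta_pair n1 (isT : 0 < 1) kp H1 e.
subst b.
have p01 : p0 = 1.
  apply: (@is_power_gen_disjoint i0 i1 i p0 p1 (q1 * q0^-1)) => //; first by apply: is_powerM => //; apply: is_powerV.
  have E : p0 * q0 = p1 * q1 by rewrite -er0.
  by rewrite -[p0](mulgK q0) E !mulgA mulVg mul1g.
have rh : r = h * q0 by rewrite -[r](mulKg h^-1) invgK er0 p01 mul1g.
by rewrite e ek' expg1 rh -{2}(comm q0 i b0 hq0) invgM !mulgA.
Qed.

Lemma theta_word h b s : (forall i, theta (x i) = h * gen (i, b) * h^-1) ->
  signed true s -> theta (wprod s) = h * wprod (map (fun c => (c.1, b)) s) * h^-1.
Proof.
move=> H; elim: s => [|[i b'] s IH].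
  by rewrite [map _ _]/= !wprod_nil theta1 mulg1 mulgV.
move=> /andP[/eqP hb hs]; rewrite -[b']/((i, b').2) hb.
by rewrite map_cons !wprod_cons thM IH // H !mulgA mulgVK.
Qed.

(** The cyclic word x y x^2 y^2 is not its own mirror image. *)
Lemma not_inverting h : ~ forall i, theta (x i) = h * gen (i, false) * h^-1.
Proof.
move=> H; pose i0 : 'I_n := Ordinal (ltnW hn); pose i1 : 'I_n := Ordinal hn.
pose v b : seq (letter n) := [:: (i0, b); (i1, b); (i0, b); (i0, b); (i1, b); (i1, b)].
have cv b : cyc_reduced (v b) by apply: (@signed_cyc _ b) => //; case: b.
have fv b : fword (wprod (v b)) = v b by rewrite fword_cyc.
have E := theta_word H (isT : signed true (v true)).
have cw : cyc_reduced (wprod (v true)) by rewrite fv.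
have ce : cyc_reduced (wprod (v false)) by rewrite fv.
(* x^-2 y^-2 occurs in the image; it is read at none of the six positions of *)
(* the circle x y x^2 y^2, in either direction                               *)
have := theta_read cw ce E (s := take 2 (v false)) (t := drop 2 (v false)) (v := [::]).
rewrite fv => /(_ (erefl _)); rewrite fv => -[y [z]].
have rt : reduced (drop 2 (v false)) by apply: (@reduced_catr _ (take 2 (v false))); rewrite cat_take_drop -fv fwordP.
move/(circ_read rt) => [[[m hm] d]] {y z}.
move/(congr1 (map (fun c : letter n => (nat_of_ord c.1, c.2)))).
case: d; do 6 (case: m hm => [|m] hm; first by vm_compute); by [].
Qed.

Lemma theta_inner : exists h, forall p, theta p = h * p * h^-1.
Proof.
have [h [[] H]] := theta_gens; last by case: (not_inverting H).
exists h => p; rewrite -[p]wprodK; elim: (fword p) => [|[i b] s IH].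
  by rewrite wprod_nil theta1 mulg1 mulgV.
have Hc : theta (gen (i, b)) = h * gen (i, b) * h^-1.
  case: b; first exact: H.
  rewrite -[(i, false)]/(linv (i, true)) gen_linv.
  apply: (mulgI (theta (x i))); rewrite -thM mulgV theta1 H.
  by rewrite !mulgA mulgVK mulgK mulgV.
by rewrite wprod_cons thM IH Hc !mulgA mulgVK.
Qed.

End Inner.

(** * The distinguishing word *)

Section Main.
Variable n : nat.
Implicit Types (phi psi : aut n) (w c d g h : fgroup n).

(** Among the size d + 1 vertices reached after c^0, ..., c^(size d), two
coincide; the power of c read between them is a loop on the circle d. *)
Lemma power_read_conj c d (x y : vert (circ d)) : cyc_reduced c -> cyc_reduced d ->
  walk x (c ^+ size d) y -> exists k g h, [/\ 0 < k, is_power d h & c ^+ k = g * h * g^-1].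
Proof.
move=> cc cd hw; have fd := circ_folded cd.
have : forall j : 'I_(size d).+1, exists z : vert (circ d), walk x (c ^+ j) z.
  move=> j; have e : c ^+ size d = c ^+ j * c ^+ (size d - j).
    by rewrite -expgnDr subnKC // -ltnS ltn_ord.
  have e' : fword (c ^+ j * c ^+ (size d - j)) = c ^+ j ++ c ^+ (size d - j).
    by apply: fwordM_size; rewrite -expgnDr !size_cycX // mulnDl.
  by move: hw; rewrite e e' => /walk_cat[z [h _]]; exists z.
move/choice => [f hf].
have [j [k [lt e]]] : exists j k : 'I_(size d).+1, j < k /\ f j = f k.
  have : ~~ injectiveb f.
    apply/negP => /injectiveP/leq_card; rewrite !card_ord; lia.
  move/injectivePn => [j [k ne e]].
  case: (ltngtP j k) => h; first by exists j, k.
    by exists k, j.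
  by move: ne; rewrite (val_inj h) eqxx.
have hl : walk (f j) (c ^+ (k - j)) (f j).
  have := walkM fd (walkV (hf j)) (hf k).
  have -> : (c ^+ j)^-1 * c ^+ k = c ^+ (k - j).
    by rewrite -{1}(subnKC (ltnW lt)) expgnDr mulKg.
  by rewrite -e.
have [h ph] := circ_dev hl; rewrite !wprodK in ph *; set p := wprod (take (f j) d) => eh.
exists (k - j)%N, p^-1, h; split=> //; first by rewrite subn_gt0.
by rewrite invgK -mulgA -eh mulKg.
Qed.

(** [power_read_conj] makes a power of phi w conjugate to a power of psi w;
applying psi^-1, the hypotheses of [theta_inner] hold for psi^-1 phi. *)
Lemma same_outer_of_read phi psi : 1 < n ->
  (forall w c d, cyc_reduced w -> fword c = cycred (phi w) -> fword d = cycred (psi w) ->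
     exists x y : vert (circ d), walk x (c ^+ size d) y) ->
  same_outer phi psi.
Proof.
move=> hn H; have [psi' k1 k2] := aut_bij psi.
have psM : {morph psi' : x y / x * y} := can2_gmulfM k1 k2.
have psV (x : fgroup n) : psi' x^-1 = (psi' x)^-1.
  by apply: (can_inj k1); rewrite k2 autV k2.
pose theta x := psi' (phi x).
have thM : {morph theta : x y / x * y} by move=> x y; rewrite /theta gmulfM psM.
have th_inj : injective theta by move=> x y /(can_inj k2)/(@aut_inj _ phi).
have thX (x : fgroup n) k : theta (x ^+ k) = theta x ^+ k.
  elim: k => [|k IH]; first by rewrite !expg0 (theta1 thM).
  by rewrite !expgS thM IH.
have [|h hh] := @theta_inner n theta hn thM th_inj.
  move=> w cw.
  have [c [ec cc [g1 eg1 _]]] := cycred_aut phi cw.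
  have [d [ed cd [g2 eg2 _]]] := cycred_aut psi cw.
  have [x [y hxy]] := H w c d cw ec ed.
  have [k [g [h' [k0 ph ek]]]] := power_read_conj cc cd hxy.
  have [h'' ph'' eh''] : exists2 h'', is_power w h'' & h' = g2^-1 * psi h'' * g2.
    have E : d = g2^-1 * psi w * g2 by rewrite eg2 !mulgA mulVg mul1g mulgVK.
    have EX (z : fgroup n) l : (g2^-1 * z * g2) ^+ l = g2^-1 * z ^+ l * g2.
      by have := conjX g2^-1 z l; rewrite invgK.
    case: ph => l [->|->].
      exists (w ^+ l); first by exists l; left.
      by rewrite E EX autX.
    exists (w^-1 ^+ l); first by exists l; right.
    by rewrite E !invgM invgK mulgA EX autX autV.
  exists k, (psi' (g1 * g * g2^-1)), h''; split=> //.
  rewrite -thX -psV /theta autX eg1 conjX ek eh'' -{2}(k1 h'') -!psM.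
  by congr psi'; rewrite !invgM invgK !mulgA.
exists (psi h) => x.
have E : phi x = psi h * psi x * (psi h)^-1.
  by rewrite -autV -!gmulfM -hh /theta k2.
by rewrite E conjgE !mulgA mulVg mul1g mulgVK.
Qed.

End Main.

Lemma distinguishing_word (n : nat) (phi psi : aut n) (hn : 1 < n) :
  ~ same_outer phi psi -> exists w c d : fgroup n,
  [/\ cyc_reduced w, fword c = cycred (phi w), fword d = cycred (psi w) &
    ~ exists x y : vert (circ d), walk x (c ^+ size d) y].
Proof.
move=> h; apply: contrapT => H; apply: h; apply: same_outer_of_read => // w c d cw ec ed.
by apply: contrapT => hw; apply: H; exists w, c, d.
Qed.

Theorem mainTheorem4 (n : nat) (hn : n <> 1%N) (phi psi : aut n)
  (hout : ~ same_outer phi psi) :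
  exists u : fgroup n, u <> 1%g /\
    (exists M, is_base_multiset phi u M) /\
    (exists N, is_base_multiset psi u N) /\
    (forall M N, is_base_multiset phi u M -> is_base_multiset psi u N -> M <> N).
Proof.
have n2 : 1 < n.
  case: n hn phi psi hout => [|[|m]] // _ phi psi [].
  have all1 (x : fgroup 0) : x = 1.
    by apply: fword_inj; case: (fword x) => // -[[]].
  by exists 1 => x; rewrite (all1 (psi x)) (all1 (_ ^ _)).
have [w [c [d [cw ec ed nr]]]] := distinguishing_word n2 hout.
have [c' [ec' cc _]] := cycred_aut phi cw.
have {ec'} ecc : c' = c by apply: fword_inj; rewrite ec'.
subst c'.
have [d' [ed' cd _]] := cycred_aut psi cw.
have {ed'} edd : d' = d by apply: fword_inj; rewrite ed'.
subst d'.
pose u := c ^+ size d.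
have u1 : u != 1.
  by rewrite -size_gt0 size_cycX // muln_gt0 !cyc_size.
exists u; split; first exact/eqP.
split; first by have [k [S hS]] := minimal_full_set_exists phi n2 u1; exists (base_mult S), k, S.
split; first by have [k [S hS]] := minimal_full_set_exists psi n2 u1; exists (base_mult S), k, S.
move=> M N [k [S [[[_ fS] _] eM]]] [k' [S' [_ eN]]] E.
have [ci hci] := circ_incl_exists phi cw.
have [h _] : exists h : hom (seg u) (circ (cycred (phi w))), true.
  rewrite -ec; have [h _] := walk_seg_hom (circ_loopX cc (size d)); by exists h.
have [i [[g _] _]] := fS w cw ci hci h.
have : 0 < M (base (S i)).
  by rewrite eM; apply/card_gt0P; exists i; rewrite inE /same_uword eqxx.
rewrite E eN => /card_gt0P[j]; rewrite inE => /orP[/eqP|/eqP] ej.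
  apply: nr; apply: (ideal_readable u1 (ip := S' j) cw ed (x := hv g ord0) (y := hv g ord_max)).
  by rewrite ej; apply: walk_hom (seg_walk _).
apply: nr; apply: (ideal_readable u1 (ip := S' j) cw ed (x := hv g ord_max) (y := hv g ord0)).
by rewrite ej; apply/walkV/walk_hom/seg_walk.
Qed.
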